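(* Let $L\to Q$ be a line bundle, let $\bar L=L\times\mathbb{R}\to Q\times\mathbb{R}$, let $\sigma_0:J^1(L^* )\times\mathbb{R}\to L^*$ be a time-dependent morphism of fiber bundles over $Q$ covering the identity, representing a time-dependent section $\sigma(y,t)=(y,\sigma_0(y,t))$ of the line bundle $J^1(L^* )\times_QL^*\to J^1(L^* )$, with autonomization $\bar\sigma$, and let $X^c_{\bar\sigma}$ be the corresponding contact Hamiltonian vector field on $J^1(\bar L^* )$. Let $S:Q\times\mathbb{R}\to L^*$ be a time-dependent section of $L^*$, $\tilde S(q,t)=(S(q,t),t)$ the corresponding section of $\bar L^*$, and $\mathcal{L}_0(S)=j^1(\tilde S)(Q\times\mathbb{R})$ the corresponding Legendre submanifold of $J^1(\bar L^* )$. The following are equivalent: (1) the map $\bar\sigma$ vanishes on $\mathcal{L}_0(S)$, i.e. $$\sigma_0\big(j^1(S_t),t\big)+\frac{\partial S}{\partial t}=0\,;$$ (2) the contact Hamiltonian vector field $X^c_{\bar\sigma}$ is tangent to the Legendre submanifold $\mathcal{L}_0(S)$ of $J^1(\bar L^* )$; (3) the vector fields $\underline{X}^c_{\bar\sigma}$ and $X^c_{\bar\sigma}$ are $j^1(\tilde S)$-related.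
   Context: All objects are smooth; line bundles are real vector bundles of rank 1; $\mathbb{R}^\times=\mathbb{R}\setminus\{0\}$; for a line bundle $E$, $E^\times$ is the set of its non-zero vectors, with $\mathbb{R}^\times$-action $h_s(v)=s\cdot v$. For any line bundle $E\to N$, the canonical contact structure on the first jet bundle $J^1(E^* )\to N$ of sections of the dual bundle is represented by $P=T^*(E^\times)$ with canonical symplectic form $\omega_{E^\times}$ (equal to $ds\wedge dp+dq^i\wedge dp_i$ in adapted coordinates $(s,q^i,p,p_j)$ coming from a local trivialization of $E$) and with $\mathbb{R}^\times$-action $\hat h_s=s\cdot(Th_{s^{-1}})^*$, for which $\hat h_s^*\omega_{E^\times}=s\,\omega_{E^\times}$. For a section $R$ of $E^*$ put $\iota_R(v)=\langle v,R(q)\rangle$, $v\in E_q^\times$. The orbit space of $\hat h$ is identified with $J^1(E^* )$ through the projection $\tau:T^*(E^\times)\to J^1(E^* )$ determined by $\tau((d\iota_R)(v))=j^1(R)(q)$ for $v\in E_q^\times$. The contact distribution is locally $\ker(dz-\mathbf{p}_i\,dq^i)$ in adapted jet coordinates $(z,q^i,\mathbf{p}_j)$; Legendre submanifolds are those tangent to it and of dimension $\dim N$. For a 1-homogeneous function $H$ on $P$ ($H\circ\hat h_s=s\cdot H$), the vector field $X_H$ given by $i_{X_H}\omega_{E^\times}=dH$ is $\tau$-projectable, and $\tau_*(X_H)$ is the contact Hamiltonian vector field on $J^1(E^* )$ associated with $H$. Time-dependent case: for the line bundle $L\to Q$ with canonical projection $\tau:T^*(L^\times)\to J^1(L^* )$,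 the time-dependent section $\sigma$ corresponds to the time-dependent 1-homogeneous Hamiltonian $H_\sigma:T^*(L^\times)\times\mathbb{R}\to\mathbb{R}$, $H_\sigma(\alpha_v,t)=\langle v,\sigma_0(\tau(\alpha_v),t)\rangle$ for $\alpha_v\in T^*_v(L^\times)$. We have $T^*(\bar L^\times)=T^*(L^\times)\times T^*\mathbb{R}$ with symplectic form $\omega_{L^\times}+dt\wedge dp$, $(t,p)$ being canonical coordinates on $T^*\mathbb{R}$. The autonomization of $H_\sigma$ is the 1-homogeneous function $\bar H_\sigma(x,t,p)=H_\sigma(x,t)+p$ on $T^*(\bar L^\times)$, and $X^c_{\bar\sigma}$ is the contact Hamiltonian vector field on $J^1(\bar L^* )$ associated with $\bar H_\sigma$. Using the canonical isomorphism $J^1(\bar L^* )\simeq(J^1(L^* )\times_QL^* )\times\mathbb{R}$, $j^1(\tilde S)(q,t)\mapsto\big(j^1(S_t)(q),\frac{\partial S}{\partial t}(q,t),t\big)$, where $S_t=S(\cdot,t)$ and $\frac{\partial S}{\partial t}(q,t)$ is regarded as an element of $L^*_q$, the section $\bar\sigma$ corresponding to $\bar H_\sigma$ is represented by the map $\bar\sigma_0:J^1(\bar L^* )\to L^*$ over $Q$, $$\bar\sigma_0\big(j^1(\tilde S)(q,t)\big)=\sigma_0\big(j^1(S_t)(q),t\big)+\frac{\partial S}{\partial t}(q,t)\,,$$ and vanishing of $\bar\sigma$ means vanishing of $\bar\sigma_0$. The canonical projection $\tau^1(\bar L^* ):J^1(\bar L^* )\to Q\times\mathbb{R}$ maps $\mathcal{L}_0(S)$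 diffeomorphically onto $Q\times\mathbb{R}$; $\underline{X}^c_{\bar\sigma}$ is the vector field on $Q\times\mathbb{R}$ which is the image under $\tau^1(\bar L^* )$ of $X^c_{\bar\sigma}$ along $\mathcal{L}_0(S)$. Being $j^1(\tilde S)$-related means $T(j^1(\tilde S))\circ\underline{X}^c_{\bar\sigma}=X^c_{\bar\sigma}\circ j^1(\tilde S)$. *)

(* Defs.v *)
(* Built on MathComp and MathComp-Analysis.

   Neither library has smooth manifolds, so the differential geometry is set up
   here.  A manifold is a type with an atlas with values in 'rV_n; its topology
   is the one transported by the charts.  An [atlas] is pure data and the axioms
   are in [is_manifold]; the manifolds constructed from a given one (products
   with R, bundles, jet and cotangent bundles) are given by their standard
   atlases.  Tangent vectors, cotangent vectors and 1-jets are equivalence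
   classes of germs of curves, functions and sections, respectively. *)
From HB Require Import structures.
From mathcomp Require Import all_boot all_order all_algebra.
From mathcomp Require Import all_classical all_reals all_analysis.

Set Implicit Arguments.
Unset Strict Implicit.
Unset Printing Implicit Defensive.

Import Order.TTheory GRing.Theory Num.Theory.
Import numFieldNormedType.Exports.

Local Open Scope classical_set_scope.
Local Open Scope ring_scope.

Definition pick_or (A : Type) (d : A) (P : A -> Prop) : A :=
  if pselect (exists x, P x) is left e then projT1 (cid e) else d.

Section SmoothFunctions.
Context (R : realType) (V W : normedModType R).

Fixpoint diff_times (k : nat) (U : set V) (f : V -> W) : Prop :=
  if k is k'.+1 then
    (forall x, U x -> differentiable f x) /\
    (forall v : V, diff_times k' U (fun x => 'd f x v))
  else True.

Definition smooth_on (U : set V) (f : V -> W) : Prop :=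
  forall k, diff_times k U f.

Definition smooth_near (f : V -> W) (x : V) : Prop :=
  exists U : set V, [/\ open U, U x & smooth_on U f].

Lemma smooth_on_cst (U : set V) (c : W) : smooth_on U (fun=> c).
Proof.
move=> k; elim: k c => [//|k IH] c /=; split=> [x _|v].
  exact: differentiable_cst.
rewrite (_ : (fun _ => _) = fun=> 0); first exact: IH.
by apply: funext => x; rewrite diff_cst.
Qed.

Lemma smooth_near_cst (c : W) (x : V) : smooth_near (fun=> c) x.
Proof. by exists setT; split=> //; [exact: openT|exact: smooth_on_cst]. Qed.

End SmoothFunctions.

Definition gradient (R : realType) (n : nat) (g : 'rV[R]_n -> R^o)
  (u : 'rV[R]_n) : 'rV[R]_n := \row_j 'd g u (delta_mx 0 j).

(** * Manifolds *)

(* [coord i] is only meaningful on the domain [dom i]. *)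
Record atlas (R : realType) (T : Type) (n : nat) := Atlas {
  chart : Type;
  dom : chart -> set T;
  coord : chart -> T -> 'rV[R]_n }.

Section Manifolds.
Context (R : realType) (T : Type) (n : nat) (M : atlas R T n).

(* The composite of f with the inverse of the chart i, extended by 0 outside
   the image of the chart. *)
Definition local_rep (W : normedModType R) (i : chart M) (f : T -> W)
  (u : 'rV[R]_n) : W :=
  if pselect (exists x, dom i x /\ coord i x = u) is left e
  then f (projT1 (cid e)) else 0.

Definition open_in (A : set T) : Prop :=
  forall i : chart M, open (coord i @` (A `&` dom i)).

Record is_manifold : Prop := {
  manifold_cover : forall x, exists i : chart M, dom i x;
  manifold_inj : forall (i : chart M) x y,
    dom i x -> dom i y -> coord i x = coord i y -> x = y;
  manifold_open : forall i : chart M, open_in (dom i);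
  manifold_smooth : forall i j : chart M,
    smooth_on (coord i @` (dom i `&` dom j)) (local_rep i (coord j));
  manifold_hausdorff : forall x y, x <> y -> exists A B : set T,
    [/\ open_in A, open_in B, A x, B y & A `&` B = set0];
  manifold_second_countable : exists2 C : set (chart M), countable C &
    forall x, exists2 i, C i & dom i x }.

Definition smooth_fun_at (f : T -> R^o) (x : T) : Prop :=
  forall i : chart M, dom i x -> smooth_near (local_rep i f) (coord i x).

Lemma smooth_fun_at0 (x : T) : smooth_fun_at (fun=> 0) x.
Proof.
move=> i _; rewrite (_ : local_rep i _ = fun=> 0); first exact: smooth_near_cst.
by apply: funext => u; rewrite /local_rep; case: pselect.
Qed.

(** ** Tangent vectors: velocities of curves *)

Definition curve_at (g : R^o -> T) (x : T) : Prop :=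
  g 0 = x /\ forall i : chart M, dom i x ->
    (\forall s \near (0 : R^o), dom i (g s)) /\ smooth_near (coord i \o g) 0.

Definition same_velocity (x : T) (g h : R^o -> T) : Prop :=
  forall i : chart M, dom i x ->
    derive1 (coord i \o g) 0 = derive1 (coord i \o h) 0.

Definition velocity_class (x : T) (g : R^o -> T) : set (R^o -> T) :=
  [set h | curve_at h x /\ same_velocity x g h].

Record tangent (x : T) := Tangent {
  tangent_class : set (R^o -> T);
  tangent_classP : exists2 g, curve_at g x & tangent_class = velocity_class x g }.

Definition tangent_repr (x : T) (v : tangent x) : R^o -> T :=
  projT1 (cid2 (tangent_classP v)).

Lemma curve_at_cst (x : T) : curve_at (fun=> x) x.
Proof.
split=> [//|i ix]; split; last exact: smooth_near_cst.
by near=> s.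
Unshelve. all: by end_near.
Qed.

Definition tangent0 (x : T) : tangent x :=
  Tangent (ex_intro2 _ _ (fun=> x) (curve_at_cst x) erefl).

(* The junk value 0 is taken when g is not a smooth curve through x. *)
Definition velocity (x : T) (g : R^o -> T) : tangent x :=
  if pselect (curve_at g x) is left h then Tangent (ex_intro2 _ _ g h erefl)
  else tangent0 x.

Definition tcoord (i : chart M) (x : T) (v : tangent x) : 'rV[R]_n :=
  derive1 (coord i \o tangent_repr v) 0.

Definition vector_field := forall x : T, tangent x.

(* For an embedded submanifold A, this says that v belongs to T_x A. *)
Definition tangent_to (A : set T) (x : T) (v : tangent x) : Prop :=
  exists2 g, tangent_class v g & \forall s \near (0 : R^o), A (g s).

(** ** Cotangent vectors: differentials of functions *)

Definition same_differential (x : T) (f g : T -> R^o) : Prop :=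
  forall i : chart M, dom i x -> forall w : 'rV[R]_n,
    'd (local_rep i f) (coord i x) w = 'd (local_rep i g) (coord i x) w.

Definition differential_class (x : T) (f : T -> R^o) : set (T -> R^o) :=
  [set g | smooth_fun_at g x /\ same_differential x f g].

Record cotangent (x : T) := Cotangent {
  cotangent_class : set (T -> R^o);
  cotangent_classP : exists2 f, smooth_fun_at f x &
    cotangent_class = differential_class x f }.

Definition cotangent_repr (x : T) (a : cotangent x) : T -> R^o :=
  projT1 (cid2 (cotangent_classP a)).

Definition cotangent0 (x : T) : cotangent x :=
  Cotangent (ex_intro2 _ _ (fun=> 0) (@smooth_fun_at0 x) erefl).

(* The differential of f at x; 0 (junk) when f is not smooth near x. *)
Definition differential (f : T -> R^o) (x : T) : cotangent x :=
  if pselect (smooth_fun_at f x) is left h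
  then Cotangent (ex_intro2 _ _ f h erefl) else cotangent0 x.

Definition cotangent_bundle := {x : T & cotangent x}.

(* Coordinates (q^i, p_i) induced by a chart of M. *)
Definition cotangent_atlas : atlas R cotangent_bundle (n + n) := {|
  chart := chart M;
  dom := fun i a => dom i (projT1 a);
  coord := fun i a => row_mx (coord i (projT1 a))
    (gradient (local_rep i (cotangent_repr (projT2 a))) (coord i (projT1 a))) |}.

Definition times_R : atlas R (T * R) (n + 1) := {|
  chart := chart M;
  dom := fun i xt => dom i xt.1;
  coord := fun i xt => row_mx (coord i xt.1) (const_mx xt.2) |}.

End Manifolds.

Section Maps.
Context (R : realType) (T T' : Type) (m n : nat).
Context (M : atlas R T m) (N : atlas R T' n).

Definition smooth_map (f : T -> T') : Prop :=
  forall x (i : chart M) (j : chart N), dom i x -> dom j (f x) ->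
    exists U : set 'rV[R]_m, [/\ open U, U (coord i x),
      U `<=` coord i @` (dom i `&` f @^-1` dom j) &
      smooth_on U (local_rep i (coord j \o f))].

Definition tangent_map (f : T -> T') (x : T) (v : tangent M x) :
  tangent N (f x) := velocity N (f x) (f \o tangent_repr v).

Definition related (f : T -> T') (X : vector_field M) (Y : vector_field N) :
  Prop := forall x, tangent_map f (X x) = Y (f x).

End Maps.

(* dq^i /\ dp_i in the coordinates (q^i, p_i) of a cotangent bundle *)
Definition canonical_form (R : realType) (m : nat) (u w : 'rV[R]_(m + m)) : R :=
  \sum_(j < m) (lsubmx u 0 j * rsubmx w 0 j - lsubmx w 0 j * rsubmx u 0 j).

(* i_X omega = dH on T^*M, expressed in every chart *)
Definition hamiltonian_field (R : realType) (T : Type) (m : nat)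
  (M : atlas R T m) (H : cotangent_bundle M -> R^o)
  (X : vector_field (cotangent_atlas M)) : Prop :=
  forall (a : cotangent_bundle M) (i : chart (cotangent_atlas M)), dom i a ->
  forall w : 'rV[R]_(m + m),
    canonical_form (tcoord i (X a)) w = 'd (local_rep i H) (coord i a) w.

(** * Line bundles *)

(* [triv a q] is the restriction to the fibre over q of the a-th local
   trivialization; it is only meaningful for q in [triv_dom a]. *)
Record line_bundle (R : realType) (T : Type) := LineBundle {
  fib : T -> vectType R;
  triv_idx : Type;
  triv_dom : triv_idx -> set T;
  triv : triv_idx -> forall q, 'Hom(fib q, R^o) }.

Section LineBundles.
Context (R : realType) (T : Type) (n : nat) (N : atlas R T n).
Context (E : line_bundle R T).

Definition frame (a : triv_idx E) (q : T) : fib E q := (triv a q)^-1%VF 1.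

Record is_line_bundle : Prop := {
  fib_dim : forall q, \dim {:fib E q} = 1%N;
  triv_cover : forall q, exists a : triv_idx E, triv_dom a q;
  triv_open : forall a : triv_idx E, open_in N (triv_dom a);
  triv_bij : forall (a : triv_idx E) q, triv_dom a q -> bijective (triv a q);
  triv_smooth : forall (a b : triv_idx E) (i : chart N),
    smooth_on (coord i @` (triv_dom a `&` triv_dom b `&` dom i))
      (local_rep i (fun q => triv b q (frame a q))) }.

Definition total_atlas : atlas R {q : T & fib E q} (n + 1) := {|
  chart := chart N * triv_idx E;
  dom := fun k => [set v | dom k.1 (projT1 v) /\ triv_dom k.2 (projT1 v)];
  coord := fun k v => row_mx (coord k.1 (projT1 v))
    (const_mx (triv k.2 (projT1 v) (projT2 v))) |}.

(* E^x, the set of non-zero vectors of E *)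
Definition nonzero_vectors := {q : T & {v : fib E q | v != 0}}.

Definition nonzero_val (v : nonzero_vectors) : fib E (projT1 v) :=
  sval (projT2 v).

Definition nonzero_atlas : atlas R nonzero_vectors (n + 1) := {|
  chart := chart N * triv_idx E;
  dom := fun k => [set v | dom k.1 (projT1 v) /\ triv_dom k.2 (projT1 v)];
  coord := fun k v => row_mx (coord k.1 (projT1 v))
    (const_mx (triv k.2 (projT1 v) (nonzero_val v))) |}.

(** ** Sections and their 1-jets *)

Definition section := forall q, fib E q.

Definition smooth_section_at (s : section) (q : T) : Prop :=
  forall (i : chart N) (a : triv_idx E), dom i q -> triv_dom a q ->
    smooth_near (local_rep i (fun q' => triv a q' (s q'))) (coord i q).

Definition same_jet (q : T) (s r : section) : Prop :=
  s q = r q /\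
  forall (i : chart N) (a : triv_idx E), dom i q -> triv_dom a q ->
  forall w : 'rV[R]_n,
    'd (local_rep i (fun q' => triv a q' (s q'))) (coord i q) w =
    'd (local_rep i (fun q' => triv a q' (r q'))) (coord i q) w.

Definition jet_set (q : T) (s : section) : set section :=
  [set r | smooth_section_at r q /\ same_jet q s r].

Record jet (q : T) := Jet {
  jet_class : set section;
  jet_classP : exists2 s, smooth_section_at s q & jet_class = jet_set q s }.

Definition jet_repr (q : T) (y : jet q) : section :=
  projT1 (cid2 (jet_classP y)).

Lemma smooth_section_at0 (q : T) : smooth_section_at (fun=> 0) q.
Proof.
move=> i a _ _; rewrite (_ : local_rep i _ = fun=> 0).
  exact: smooth_near_cst.
by apply: funext => u; rewrite /local_rep; case: pselect => // e; rewrite linear0.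
Qed.

Definition jet0 (q : T) : jet q :=
  Jet (ex_intro2 _ _ (fun=> 0) (@smooth_section_at0 q) erefl).

(* j^1(s)(q); the jet of the zero section (junk) when s is not smooth near q. *)
Definition jet_of (s : section) (q : T) : jet q :=
  if pselect (smooth_section_at s q) is left h
  then Jet (ex_intro2 _ _ s h erefl) else jet0 q.

Definition jet_bundle := {q : T & jet q}.

Definition jet_prolongation (s : section) (q : T) : jet_bundle :=
  existT _ q (jet_of s q).

Definition jet_proj (y : jet_bundle) : T := projT1 y.

(* Adapted coordinates (q^i, z, p_j): z is the value of the section in the
   trivialization and p_j its partial derivatives. *)
Definition jet_atlas : atlas R jet_bundle (n + 1 + n) := {|
  chart := chart N * triv_idx E;
  dom := fun k => [set y | dom k.1 (projT1 y) /\ triv_dom k.2 (projT1 y)];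
  coord := fun k y =>
    let q := projT1 y in let s := jet_repr (projT2 y) in
    row_mx (row_mx (coord k.1 q) (const_mx (triv k.2 q (s q))))
      (gradient (local_rep k.1 (fun q' => triv k.2 q' (s q'))) (coord k.1 q)) |}.

End LineBundles.

(* A trivialization of E, with local frame e, induces f |-> f(e) on E^*. *)
Definition dual (R : realType) (T : Type) (E : line_bundle R T) :
  line_bundle R T := {|
  fib := fun q => 'Hom(fib E q, R^o);
  triv_idx := triv_idx E;
  triv_dom := @triv_dom R T E;
  triv := fun a q => linfun (fun f : 'Hom(fib E q, R^o) => f (frame a q)) |}.

(* L x R -> Q x R *)
Definition bar (R : realType) (T : Type) (L : line_bundle R T) :
  line_bundle R (T * R) := {|
  fib := fun qt => fib L qt.1;
  triv_idx := triv_idx L;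
  triv_dom := fun a => [set qt | triv_dom a qt.1];
  triv := fun a qt => triv a qt.1 |}.

(** * Contact Hamiltonian vector fields on J^1(E^* ) *)

Section Contact.
Context (R : realType) (T : Type) (n : nat) (N : atlas R T n).
Context (E : line_bundle R T).

Local Notation P := (cotangent_bundle (nonzero_atlas N E)).

Definition iota (s : section (dual E)) (v : nonzero_vectors E) : R^o :=
  s (projT1 v) (nonzero_val v).

(* tau((d iota_s)(v)) = j^1(s)(q) for v in E_q^x *)
Definition tau_jet (a : P) : jet N (dual E) (projT1 (projT1 a)) :=
  pick_or (jet0 _ _ _) (fun y => exists s : section (dual E),
    [/\ smooth_section_at N s (projT1 (projT1 a)),
        projT2 a = differential (nonzero_atlas N E) (iota s) (projT1 a) &
        y = jet_of N s (projT1 (projT1 a))]).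

Definition tau (a : P) : jet_bundle N (dual E) :=
  existT _ (projT1 (projT1 a)) (tau_jet a).

(* Xc = tau_*(X_H) *)
Definition contact_hamiltonian_field (H : P -> R^o)
  (Xc : vector_field (jet_atlas N (dual E))) : Prop :=
  exists2 X : vector_field (cotangent_atlas (nonzero_atlas N E)),
    hamiltonian_field H X & related tau X Xc.

End Contact.

(** * The time-dependent case *)

Section TimeDependent.
Context (R : realType) (T : Type) (n : nat) (Q : atlas R T n).
Context (L : line_bundle R T).

Definition time_dep_morphism :=
  forall y : jet_bundle Q (dual L), R -> fib (dual L) (projT1 y).

Definition smooth_time_dep_morphism (sigma0 : time_dep_morphism) : Prop :=
  smooth_map (times_R (jet_atlas Q (dual L))) (total_atlas Q (dual L))
    (fun yt => existT _ (projT1 yt.1) (sigma0 yt.1 yt.2)).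

Definition time_dep_section := forall q : T, R -> fib (dual L) q.

Definition smooth_time_dep_section (S : time_dep_section) : Prop :=
  smooth_map (times_R Q) (total_atlas Q (dual L))
    (fun qt => existT _ qt.1 (S qt.1 qt.2)).

Definition suspend (S : time_dep_section) : section (dual (bar L)) :=
  fun qt => S qt.1 qt.2.

(* The derivative of a curve in the fibre L_q^*, computed on each vector of
   L_q. *)
Definition time_derivative (q : T) (c : R -> fib (dual L) q) (t : R) :
  fib (dual L) q := linfun (fun v : fib L q => derive1 (fun s => c s v) t : R^o).

Definition H_sigma (sigma0 : time_dep_morphism)
  (a : cotangent_bundle (nonzero_atlas Q L)) (t : R) : R^o :=
  sigma0 (tau a) t (nonzero_val (projT1 a)).

Definition at_time (t : R) (v : nonzero_vectors L) : nonzero_vectors (bar L) :=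
  @existT _ (fun qt => {v : fib (bar L) qt | v != 0}) (projT1 v, t) (projT2 v).

Definition space_part (w : nonzero_vectors (bar L)) : nonzero_vectors L :=
  @existT _ (fun q => {v : fib L q | v != 0}) (projT1 w).1 (projT2 w).

Definition time_part (w : nonzero_vectors (bar L)) : R := (projT1 w).2.

Local Notation barP := (cotangent_bundle (nonzero_atlas (times_R Q) (bar L))).

(* The two components of T^*(L^x x R) -> T^*(L^x) x T^*R: the differentials
   of v |-> F(v, t) and of t |-> F(v, t), where the covector is dF(v, t). *)
Definition cotangent_space_part (a : barP) :
  cotangent_bundle (nonzero_atlas Q L) :=
  existT _ (space_part (projT1 a))
    (differential (nonzero_atlas Q L)
      (cotangent_repr (projT2 a) \o at_time (time_part (projT1 a)))
      (space_part (projT1 a))).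

Definition cotangent_momentum (a : barP) : R^o :=
  derive1 (fun s : R =>
      cotangent_repr (projT2 a) (at_time s (space_part (projT1 a))))
    (time_part (projT1 a)).

Definition H_bar (sigma0 : time_dep_morphism) (a : barP) : R^o :=
  H_sigma sigma0 (cotangent_space_part a) (time_part (projT1 a))
  + cotangent_momentum a.

(* A jet of J^1(bar L^* ) is j^1(r)(q, t) for a local section r of bar L^*,
   which is of the form suspend S. *)
Definition sigma_bar0 (sigma0 : time_dep_morphism)
  (y : jet_bundle (times_R Q) (dual (bar L))) : fib (dual L) (projT1 y).1 :=
  let q := (projT1 y).1 in
  let t := (projT1 y).2 in
  let S : time_dep_section := fun q' s => jet_repr (projT2 y) (q', s) in
  sigma0 (jet_prolongation Q (S^~ t : section (dual L)) q) t
  + time_derivative (S q) t.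

(* j^1(tilde S) : Q x R -> J^1(bar L^* ) and its image L_0(S) *)
Definition j1_tilde (S : time_dep_section) :
  T * R -> jet_bundle (times_R Q) (dual (bar L)) :=
  jet_prolongation (times_R Q) (suspend S).

Definition legendre (S : time_dep_section) :
  set (jet_bundle (times_R Q) (dual (bar L))) := range (j1_tilde S).

Definition projected_field (S : time_dep_section)
  (Xc : vector_field (jet_atlas (times_R Q) (dual (bar L)))) :
  vector_field (times_R Q) :=
  fun qt => tangent_map (times_R Q) (@jet_proj _ _ _ _ _) (Xc (j1_tilde S qt)).

End TimeDependent.

Arguments smooth_time_dep_morphism {R T n} Q {L} sigma0.
Arguments smooth_time_dep_section {R T n} Q {L} S.
Arguments sigma_bar0 {R T n Q L} sigma0 y.
Arguments j1_tilde {R T n} Q {L} S _.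
Arguments legendre {R T n} Q {L} S _.
Arguments projected_field {R T n Q L} S Xc _.
Arguments jet_prolongation {R T n} N {E} s q.

(* Main.v *)
(** In the coordinates (x, s, p, z) of T^*(E^x) and (x, z, P) of J^1(E^* ), where
    x are coordinates of the base, s is the coordinate along the fibre of E and
    z its momentum, the projection tau reads (x, s, p, z) |-> (x, z, p/s).  A
    1-homogeneous Hamiltonian is H = s h(x, z, p/s), so at s = 1 Hamilton's
    equations project to the contact equations
      x' = h_P,   z' = P.x' - h,   P' = - h_x - P h_z.
    A vector tangent to the graph z = S(x), P = dS(x) satisfies z' = P.x', hence
    h = 0 there.  Conversely, if h vanishes on the graph, differentiating
    h(x, S(x), dS(x)) = 0 and using the symmetry of the second derivative of S
    gives P' = D(dS)(x'), so the contact vector is the image under j^1(S) of its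
    projection x'.  The time-dependent statement is this one for the line bundle
    bar L, since H_bar is the 1-homogeneous Hamiltonian of sigma_bar0. *)
Require Import Defs.
From HB Require Import structures.
From mathcomp Require Import all_boot all_order all_algebra.
From mathcomp Require Import all_classical all_reals all_analysis.
From mathcomp Require Import ring.
(* Imported again because [coord] is also a name of the algebra library. *)
Require Import Defs.
Import Order.TTheory GRing.Theory Num.Theory.
Import numFieldNormedType.Exports.
Local Open Scope classical_set_scope.
Local Open Scope ring_scope.
Set Implicit Arguments.
Unset Strict Implicit.
Unset Printing Implicit Defensive.

(** * Differentials and smooth functions *)

Section ScaleBilinear.
Context (R : realType) (W : normedModType R).

(** Local representatives are extended by 0 outside the image of a chart, so an identity between
    them can be differentiated only once it is known on a neighbourhood. For a Hamiltonian this
    needs every coordinate vector close to that of a covector to be itself the coordinate vector of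
    a covector, that is, every value of the momenta has to be realised. The projection tau is
    defined by choosing a section. Its formula in coordinates comes from d(s Z(x)) = (s dZ, Z),
    which fixes the value and the slope of whatever section was chosen. Evaluating at s = 1 loses
    nothing: above each jet j^1(S)(q) lies the covector d(iota_S)(v) with v the frame vector at q,
    and tau-relatedness determines the contact field from that single point of the fibre. The
    equivalence of (2) and (3) does not involve the Hamiltonian. A vector tangent to the image of a
    section is determined by its projection to the base; conversely, a pushed-forward vector is the
    velocity of a curve lying in that image. The Hamiltonian is differentiated once only, whereas S
    is differentiated twice. *)

Definition scale_fun (r : R^o) (w : W) : W := r *: w.

(** With scaling seen as a bilinear map, the Leibniz rule for a scalar function times a
    vector-valued one is an instance of the differential of a continuous bilinear map. *)
Lemma scale_fun_is_bilinear :
  bilinear_for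
    (GRing.Scale.Law.clone _ _ *:%R _) (GRing.Scale.Law.clone _ _ *:%R _)
    scale_fun.
Proof.
split=> [w|r] a x y; rewrite /scale_fun.
  by rewrite scalerDl -[in LHS]scalerA.
by rewrite scalerDr /= !scalerA [r * a]mulrC.
Qed.
HB.instance Definition _ :=
  bilinear_isBilinear.Build R R^o W W _ _ scale_fun scale_fun_is_bilinear.

End ScaleBilinear.

Section Differentials.
Context {R : realType}.
Implicit Types V W : normedModType R.

Lemma linear_rV_continuous m W (f : {linear 'rV[R]_m -> W}) : continuous f.
Proof.
have -> : (f : 'rV[R]_m -> W) =
    (fun v => \sum_(j < m) (v 0 j : R^o) *: f (delta_mx 0 j)).
  apply: funext => v; rewrite {1}[v]row_sum_delta linear_sum.
  by apply: eq_bigr => j _; rewrite linearZ.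
have := @differentiable_sum R 'rV[R]_m W m
  (fun j v => (v 0 j : R^o) *: f (delta_mx 0 j)).
rewrite (_ : \sum_(i < m) _ = 
  (fun v : 'rV[R]_m => \sum_(j < m) (v 0 j : R^o) *: f (delta_mx 0 j))).
  move=> H v; apply: differentiable_continuous; apply: H => j.
  exact/differentiableZl/differentiable_coord.
by apply: funext => v; rewrite fct_sumE.
Qed.

(** The first-order expansion at [x] sees only the germ of the function, and the linear part of such
    an expansion is unique. *)
Lemma near_eq_is_diff V W (f g : V -> W) (x : V) :
  (\forall y \near x, f y = g y) -> differentiable f x ->
  differentiable g x /\ forall v, 'd g x v = 'd f x v.
Proof.
move=> fg df.
have fgx : f x = g x by exact: nbhs_singleton fg.
have H : g \o shift x = cst (g x) + 'd f x +o_ 0 id.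
  apply/eqaddoP => e e0; rewrite -fgx.
  have /eqaddoP /(_ e e0) := diff_locally df.
  move: fg; rewrite (near_shift 0) subr0 => fg.
  by apply: filterS2 fg => z /=; rewrite !fctE /= => ->.
have dg : 'd g x = 'd f x :> (V -> W).
  by apply: diff_unique H; exact: diff_continuous.
split; last by move=> v; rewrite dg.
by apply/diff_locallyP; rewrite dg; split=> //; exact: diff_continuous.
Qed.

Lemma diff_linear_comp V W (W' : normedModType R) (f : V -> W)
    (L : {linear W -> W'}) x : continuous L -> differentiable f x ->
  differentiable (fun y => L (f y)) x /\
  forall v, 'd (fun y => L (f y)) x v = L ('d f x v).
Proof.
move=> Lc df; have dL : differentiable L (f x) by exact: linear_differentiable.
split; first exact: differentiable_comp df dL.
by move=> v; rewrite (congr1 (@^~ v) (diff_comp df dL)) /= diff_lin.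
Qed.

Lemma diff_add V W (f g : V -> W) x :
  differentiable f x -> differentiable g x ->
  differentiable (fun y => f y + g y) x /\
  forall v, 'd (fun y => f y + g y) x v = 'd f x v + 'd g x v.
Proof.
move=> df dg; split; first exact: differentiableD df dg.
exact: (fun v => congr1 (fun h => h v) (diffD df dg)).
Qed.

Lemma diff_inv V (c : V -> R^o) x : differentiable c x -> c x != 0 ->
  differentiable (fun y => (c y)^-1 : R^o) x /\
  forall v, 'd (fun y => (c y)^-1 : R^o) x v = - (c x) ^- 2 *: ('d c x v : R^o).
Proof.
move=> dc c0; split; first exact: differentiableV.
exact: (fun v => congr1 (fun h => h v) (diffV dc c0)).
Qed.

Lemma diff_rV_comp V W m (f : V -> 'rV[R]_m) (g : 'rV[R]_m -> W) x :
  differentiable f x -> differentiable g (f x) ->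
  differentiable (fun y => g (f y)) x /\
  forall v, 'd (fun y => g (f y)) x v = 'd g (f x) ('d f x v).
Proof.
move=> df dg; split; first exact: differentiable_comp df dg.
exact: (fun v => congr1 (fun h => h v) (diff_comp df dg)).
Qed.

Lemma diff_scaleM V W (k : V -> R^o) (f : V -> W) x :
  differentiable k x -> differentiable f x ->
  differentiable (fun y => k y *: f y) x /\
  forall v, 'd (fun y => k y *: f y) x v =
    k x *: 'd f x v + ('d k x v : R^o) *: f x.
Proof.
move=> dk df.
have Bc : continuous (fun p : R^o * W => scale_fun p.1 p.2).
  by move=> [r w]; apply: scale_continuous.
have dB := differentiable_bilin _ Bc.
have dkf := differentiable_pair dk df.
split; first exact: differentiable_comp dkf (dB _).
move=> v; rewrite (congr1 (@^~ v) (diff_comp dkf (dB _))) /=.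
by rewrite diff_bilin // diff_pair.
Qed.

Definition as_linear (V W : lmodType R) (f : V -> W) (Hf : linear f) :
  {linear V -> W} := HB.pack f (GRing.isLinear.Build _ _ _ _ f Hf).

Lemma coord_is_linear m j : linear (fun u : 'rV[R]_m => u 0 j : R^o).
Proof. by move=> a u w; rewrite !mxE. Qed.

Definition coord_linear m (j : 'I_m) := as_linear (@coord_is_linear m j).

Lemma diff_rV V m (f : V -> 'rV[R]_m) x :
  (forall j, differentiable (fun y => f y 0 j : R^o) x) ->
  differentiable f x /\
  forall v, 'd f x v = \row_j 'd (fun y => f y 0 j : R^o) x v.
Proof.
move=> df.
have fE : f = \sum_(j < m) (fun y => (f y 0 j : R^o) *: delta_mx 0 j).
  by apply: funext => y; rewrite fct_sumE {1}[f y]row_sum_delta.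
have Df : differentiable f x.
  rewrite fE; apply: differentiable_sum => j; exact: differentiableZl.
split=> //; move=> v; apply/rowP => j; rewrite mxE.
by have [_ /= ->] := diff_linear_comp
  (@linear_rV_continuous _ _ (coord_linear j)) Df.
Qed.

End Differentials.

(** * Stability of iterated differentiability under algebraic operations and composition *)

Section Smooth.
Context {R : realType}.
Implicit Types V W : normedModType R.

Lemma diff_times_ext V W k (U : set V) (f g : V -> W) :
  open U -> (forall x, U x -> f x = g x) ->
  diff_times k U f -> diff_times k U g.
Proof.
move=> oU; elim: k f g => [//|k IH] f g fg [df Df].
have H x : U x -> differentiable g x /\ forall v, 'd g x v = 'd f x v.
  move=> Ux; apply: near_eq_is_diff (df _ Ux).
  by apply: filterS fg _; exact: open_nbhs_nbhs.
split=> [x /H[]//|v]; apply: IH (Df v) => x /H[_ ->]//.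
Qed.

Lemma diff_times_sub V W k (U U' : set V) (f : V -> W) :
  U' `<=` U -> diff_times k U f -> diff_times k U' f.
Proof.
move=> sU; elim: k f => [//|k IH] f [df Df].
by split=> [x /sU /df//|v]; exact: IH (Df v).
Qed.

Lemma diff_timesW V W k (U : set V) (f : V -> W) :
  diff_times k.+1 U f -> diff_times k U f.
Proof.
elim: k f => [//|k IH] f [df Df].
by split=> // v; apply: IH; exact: Df.
Qed.

Lemma diff_times_linear V W k (U : set V) (L : {linear V -> W}) :
  continuous L -> diff_times k U L.
Proof.
move=> Lc; case: k => [//|k]; split=> [x _|v].
  exact: linear_differentiable.
rewrite (_ : (fun x => _) = fun=> L v); first exact: smooth_on_cst.
by apply: funext => x; rewrite diff_lin.
Qed.

Lemma diff_times_linear_comp V W (W' : normedModType R) k (U : set V)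
    (f : V -> W) (L : {linear W -> W'}) :
  open U -> continuous L -> diff_times k U f ->
  diff_times k U (fun x => L (f x)).
Proof.
move=> oU Lc; elim: k f => [//|k IH] f [df Df].
split=> [x /df dfx|v]; first by have [] := diff_linear_comp Lc dfx.
apply: diff_times_ext (IH _ (Df v)) => // x /df dfx.
by have [_ ->] := diff_linear_comp Lc dfx.
Qed.

Lemma diff_timesD V W k (U : set V) (f g : V -> W) :
  open U -> diff_times k U f -> diff_times k U g ->
  diff_times k U (fun x => f x + g x).
Proof.
move=> oU; elim: k f g => [//|k IH] f g [df Df] [dg Dg].
split=> [x Ux|v]; first exact: differentiableD (df _ Ux) (dg _ Ux).
apply: (diff_times_ext oU _ (IH _ _ (Df v) (Dg v))) => x Ux.
exact: esym ((diff_add (df _ Ux) (dg _ Ux)).2 v).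
Qed.

Lemma diff_timesM V W k (U : set V) (c : V -> R^o) (f : V -> W) :
  open U -> diff_times k U c -> diff_times k U f ->
  diff_times k U (fun x => c x *: f x).
Proof.
move=> oU; elim: k c f => [//|k IH] c f Hc Hf.
have [[dc Dc] [df Df]] := (Hc, Hf).
have H x (Ux : U x) := diff_scaleM (dc _ Ux) (df _ Ux).
split=> [x /H[]//|v]; apply: (@diff_times_ext _ _ _ _
  (fun x => c x *: 'd f x v + ('d c x v : R^o) *: f x)) => //.
  by move=> x Ux; exact: esym ((H x Ux).2 v).
by apply: diff_timesD; [exact: oU | exact: IH (diff_timesW Hc) (Df v) |
  exact: IH (Dc v) (diff_timesW Hf)].
Qed.

Lemma diff_times_sum V W k (U : set V) m (f : 'I_m -> V -> W) :
  open U -> (forall j, diff_times k U (f j)) ->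
  diff_times k U (fun x => \sum_j f j x).
Proof.
move=> oU; elim: m f => [|m IH] f Hf.
  apply: (diff_times_ext oU _ (smooth_on_cst U 0 k)) => x _.
  by rewrite big_ord0.
apply: (diff_times_ext oU _ (diff_timesD oU (IH _ _) (Hf ord_max))) => [x _|j].
  by rewrite big_ord_recr.
exact: Hf.
Qed.

(** Iterated differentiability speaks of derivatives in fixed directions, but the chain rule
    differentiates [g] in the moving direction ['d f x v]. Expanding this direction in the standard
    basis of the middle space turns the derivative into a sum of products in which [g] is
    differentiated along fixed basis vectors; this is why the middle space is a space of row
    vectors. *)
Lemma diff_times_comp V W k m (U : set V) (U' : set 'rV[R]_m)
    (f : V -> 'rV[R]_m) (g : 'rV[R]_m -> W) :
  open U -> (forall x, U x -> U' (f x)) -> diff_times k U f ->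
  diff_times k U' g -> diff_times k U (fun x => g (f x)).
Proof.
move=> oU UU'; elim: k g => [//|k IH] g Hf [dg Dg]; have [df Df] := Hf.
split=> [x Ux|v].
  exact: differentiable_comp (df _ Ux) (dg _ (UU' _ Ux)).
apply: (diff_times_ext oU (f := fun x =>
  \sum_(j < m) ('d f x v 0 j : R^o) *: 'd g (f x) (delta_mx 0 j))).
  move=> x Ux.
  rewrite [RHS]((diff_rV_comp (df _ Ux) (dg _ (UU' _ Ux))).2 v).
  rewrite [X in _ = 'd g (f x) X]row_sum_delta linear_sum.
  by apply: eq_bigr => j _; rewrite linearZ.
apply: diff_times_sum => // j; apply: diff_timesM => //.
  exact: (diff_times_linear_comp oU
    (@linear_rV_continuous _ _ _ (coord_linear j)) (Df v)).
exact: IH (diff_timesW Hf) (Dg _).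
Qed.

Lemma diff_timesV V k (U : set V) (c : V -> R^o) :
  open U -> (forall x, U x -> c x != 0) -> diff_times k U c ->
  diff_times k U (fun x => (c x)^-1 : R^o).
Proof.
move=> oU c0; elim: k c c0 => [//|k IH] c c0 Hc; have [dc Dc] := Hc.
split=> [x Ux|v]; first exact: differentiableV (dc _ Ux) (c0 _ Ux).
have Hi := IH c c0 (diff_timesW Hc).
(* The derivative -c^-2 dc is written with two separate factors 1/c, so that the induction
   hypothesis for 1/c applies to each. *)
apply: (diff_times_ext oU (f := fun x =>
  (- 1 : R^o) *: (((c x)^-1 : R^o) *: (((c x)^-1 : R^o) *: ('d c x v : R^o))) : R^o)).
  move=> x Ux; rewrite [RHS]((diff_inv (dc _ Ux) (c0 _ Ux)).2 v).
  by rewrite scaleN1r scalerA scaleNr -invfM -expr2.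
have H1 := diff_timesM oU Hi (Dc v).
exact: diff_timesM oU (smooth_on_cst _ _ _) (diff_timesM oU Hi H1).
Qed.

End Smooth.

Section SmoothNear.
Context {R : realType}.
Implicit Types V W : normedModType R.

Lemma near_open V (P : set V) x :
  (\forall y \near x, P y) -> exists A, [/\ open A, A x & A `<=` P].
Proof.
move=> nP; have : nbhs x P by [].
by rewrite nbhsE => -[A [oA Ax] AP]; exists A.
Qed.

Lemma smooth_near_ext V W (f g : V -> W) x :
  (\forall y \near x, f y = g y) -> smooth_near f x -> smooth_near g x.
Proof.
move=> /near_open[A [oA Ax fg]] [U [oU Ux fU]].
exists (U `&` A); split=> [||k]; [exact: openI|by []|].
apply: (diff_times_ext (f := f)); first exact: openI.
  by move=> y [_ /fg].
by apply: diff_times_sub (fU k) => y [].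
Qed.

Lemma smooth_near_near V W (f : V -> W) x :
  smooth_near f x -> \forall y \near x, smooth_near f y.
Proof.
move=> [U [oU Ux fU]]; apply: filterS (open_nbhs_nbhs (conj oU Ux)) => y Uy.
by exists U.
Qed.

Lemma smooth_near_differentiable V W (f : V -> W) x :
  smooth_near f x -> differentiable f x.
Proof. by move=> [U [oU Ux fU]]; have [H _] := fU 1%N; exact: H. Qed.

Lemma smooth_near_diff V W (f : V -> W) x v :
  smooth_near f x -> smooth_near (fun y => 'd f y v) x.
Proof.
by move=> [U [oU Ux fU]]; exists U; split=> // k; exact: (fU k.+1).2 v.
Qed.

Lemma smooth_near_linear V W (L : {linear V -> W}) x :
  continuous L -> smooth_near L x.
Proof.
move=> Lc; exists setT; split=> // [|k]; first exact: openT.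
exact: diff_times_linear.
Qed.

Lemma smooth_near_linear_comp V W (W' : normedModType R) (f : V -> W)
    (L : {linear W -> W'}) x :
  continuous L -> smooth_near f x -> smooth_near (fun y => L (f y)) x.
Proof.
move=> Lc [U [oU Ux fU]]; exists U; split=> // k.
exact: diff_times_linear_comp oU Lc (fU k).
Qed.

Lemma smooth_nearD V W (f g : V -> W) x :
  smooth_near f x -> smooth_near g x -> smooth_near (fun y => f y + g y) x.
Proof.
move=> [U [oU Ux fU]] [U' [oU' Ux' gU]]; have oI := openI oU oU'.
exists (U `&` U'); split=> // k; apply: diff_timesD oI _ _.
  by apply: diff_times_sub (fU k) => y [].
by apply: diff_times_sub (gU k) => y [].
Qed.

Lemma smooth_nearM V W (c : V -> R^o) (f : V -> W) x :
  smooth_near c x -> smooth_near f x -> smooth_near (fun y => c y *: f y) x.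
Proof.
move=> [U [oU Ux fU]] [U' [oU' Ux' gU]]; have oI := openI oU oU'.
exists (U `&` U'); split=> // k; apply: diff_timesM oI _ _.
  by apply: diff_times_sub (fU k) => y [].
by apply: diff_times_sub (gU k) => y [].
Qed.

Lemma smooth_near_comp V W m (f : V -> 'rV[R]_m) (g : 'rV[R]_m -> W) x :
  smooth_near f x -> smooth_near g (f x) -> smooth_near (fun y => g (f y)) x.
Proof.
move=> sf [U' [oU' Ux' gU]].
have := differentiable_continuous (smooth_near_differentiable sf).
move=> /(_ U') /(_ (open_nbhs_nbhs (conj oU' Ux'))).
move=> /near_open[A [oA Ax AU]].
have [U [oU Ux fU]] := sf; have oI := openI oU oA.
exists (U `&` A); split=> // k.
apply: (diff_times_comp oI _ _ (gU k)); first by move=> y [_ /AU].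
by apply: diff_times_sub (fU k) => y [].
Qed.

Lemma smooth_near_inv V (c : V -> R^o) x :
  c x != 0 -> smooth_near c x -> smooth_near (fun y => (c y)^-1 : R^o) x.
Proof.
move=> cx0 sf.
have := differentiable_continuous (smooth_near_differentiable sf).
have c0 : open [set r : R^o | r != 0] by exact: open_neq.
move=> /(_ [set r : R^o | r != 0]) /(_ (open_nbhs_nbhs (conj c0 cx0))).
move=> /near_open[A [oA Ax AU]].
have [U [oU Ux fU]] := sf; have oI := openI oU oA.
exists (U `&` A); split=> // k.
apply: diff_timesV oI _ _; first by move=> y [_ /AU].
by apply: diff_times_sub (fU k) => y [].
Qed.

Lemma smooth_near_sum V W m (f : 'I_m -> V -> W) x :
  (forall j, smooth_near (f j) x) -> smooth_near (fun y => \sum_j f j y) x.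
Proof.
elim: m f => [|m IH] f Hf.
  apply: (smooth_near_ext _ (smooth_near_cst 0 x)); near=> y.
  by rewrite big_ord0.
apply: (smooth_near_ext _ (smooth_nearD (IH _ _) (Hf ord_max))) => [|j].
  by near=> y; rewrite big_ord_recr.
exact: Hf.
Unshelve. all: by end_near. Qed.

Lemma smooth_near_rV V m (f : V -> 'rV[R]_m) x :
  (forall j, smooth_near (fun y => f y 0 j : R^o) x) -> smooth_near f x.
Proof.
move=> Hf; apply: (@smooth_near_ext _ _ (fun y =>
  \sum_(j < m) (f y 0 j : R^o) *: (delta_mx 0 j : 'rV[R]_m))).
  by near=> y; rewrite [RHS]row_sum_delta.
apply: smooth_near_sum => j.
exact: smooth_nearM (Hf j) (smooth_near_cst _ _).
Unshelve. all: by end_near. Qed.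

Lemma smooth_near_coord V m (f : V -> 'rV[R]_m) x j :
  smooth_near f x -> smooth_near (fun y => f y 0 j : R^o) x.
Proof.
exact: smooth_near_linear_comp (@linear_rV_continuous _ _ _ (coord_linear j)).
Qed.

End SmoothNear.

(** * Symmetry of second derivatives *)

Section Schwarz.
Context {R : realType} {V : normedModType R}.
Implicit Types (f : V -> R^o) (x v w : V).

Lemma is_derive_line f x v (s : R) : differentiable f (x + s *: v) ->
  is_derive s 1 (fun s => f (x + s *: v)) ('d f (x + s *: v) v).
Proof.
move=> df; pose g (r : R^o) : V := x + r *: v.
have di : differentiable (@id R^o) (s : R^o) by exact: ex_diff.
have [dl el] := diff_scaleM di (differentiable_cst v (s : R^o)).
have [dg eg] := diff_add (differentiable_cst x (s : R^o)) dl.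
have gs : 'd g (s : R^o) 1 = v.
  rewrite [LHS]eg diff_cst add0r [LHS]el diff_cst scaler0 add0r.
  by rewrite diff_val scale1r.
have dfg : differentiable (f \o g) s by exact: differentiable_comp.
apply: DeriveDef; first exact: diff_derivable.
rewrite deriveE //.
exact: (etrans (congr1 (fun h => h (1 : R)) (diff_comp dg df))
  (congr1 ('d f (x + s *: v)) gs)).
Qed.

Lemma MVT0 (phi dphi : R -> R) (h : R) : 0 < h ->
  (forall s : R, 0 <= s <= h -> is_derive s 1 phi (dphi s)) ->
  exists2 s, 0 <= s <= h & phi h - phi 0 = dphi s * h.
Proof.
move=> h0 Hd; have [||s] := @MVT R phi dphi 0 h h0.
- by move=> s; rewrite in_itv /= => /andP[/ltW a /ltW b]; apply: Hd; rewrite a b.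
- apply: derivable_within_continuous => s; rewrite in_itv /= => Hs.
  by have := Hd s Hs.
- rewrite in_itv /= => /andP[/ltW a /ltW b] e; exists s; first by rewrite a b.
  by rewrite e subr0.
Qed.

(** The mean value theorem is used twice: along [v] for the difference of [f] on two parallel
    segments that are [h *: w] apart, then along [w] for the resulting derivative in the direction
    [v]. *)
Lemma second_difference f x v w (h : R) : 0 < h ->
  (forall s t : R, 0 <= s <= h -> 0 <= t <= h ->
    differentiable f (x + s *: v + t *: w) /\
    differentiable (fun y => 'd f y v : R^o) (x + s *: v + t *: w)) ->
  exists s t, [/\ 0 <= s <= h, 0 <= t <= h &
    f (x + h *: v + h *: w) - f (x + h *: w) - (f (x + h *: v) - f x) =
    'd (fun y => 'd f y v : R^o) (x + s *: v + t *: w) w * h * h].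
Proof.
move=> h0 Hd; have hh : 0 <= h <= h by rewrite ltW /=.
have h00 : 0 <= (0 : R) <= h by rewrite lexx ltW.
have ac s t : x + s *: v + t *: w = x + t *: w + s *: v by rewrite addrAC.
have [|s Hs e] := @MVT0 (fun s => f (x + h *: w + s *: v) - f (x + s *: v))
   (fun s => 'd f (x + h *: w + s *: v) v - 'd f (x + s *: v) v) h h0.
  move=> s Hs; apply: is_deriveB; apply: is_derive_line.
    by rewrite -ac; exact: (Hd s h Hs hh).1.
  by have := (Hd s 0 Hs h00).1; rewrite scale0r addr0.
have [|t Ht e'] := @MVT0 (fun t => 'd f (x + s *: v + t *: w) v)
   (fun t => 'd (fun y => 'd f y v : R^o) (x + s *: v + t *: w) w) h h0.
  move=> t Ht; apply: (@is_derive_line (fun y => 'd f y v : R^o)).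
  exact: (Hd s t Hs Ht).2.
exists s, t; split=> //; rewrite -e'.
move: e; rewrite !scale0r !addr0 -!ac opprB => <-.
by rewrite !opprB; ring.
Qed.

(** The second difference is symmetric in [v] and [w], so on arbitrarily small parallelograms each
    mixed derivative takes a value that the other one takes too; continuity of both at [x] excludes
    a gap. Here [e] is half of the supposed gap. *)
Lemma diff_diffC f x v w : smooth_near f x ->
  'd (fun y => 'd f y v) x w = 'd (fun y => 'd f y w) x v.
Proof.
move=> sf; apply/eqP/negPn/negP => ne.
pose A v w y := 'd (fun z => 'd f z v : R^o) y w.
have cA v' w' : {for x, continuous (A v' w' : V -> R^o)}.
  apply: differentiable_continuous; apply: smooth_near_differentiable.
  do 2! apply: smooth_near_diff => //.
pose e := `|A v w x - A w v x| / 2.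
have e0 : 0 < e by rewrite divr_gt0 // normr_gt0 subr_eq0.
have Hnear : \forall y \near x, [/\ smooth_near f y,
    `|A v w x - A v w y| < e & `|A w v x - A w v y| < e].
  near=> y; split; near: y; first exact: smooth_near_near.
    by have /cvgrPdist_lt := cA v w; exact.
  by have /cvgrPdist_lt := cA w v; exact.
have [r /= r0 Hr] := (nbhs_normP _ _).1 Hnear.
(* A point of the parallelogram of size [h] is at distance at most [h * N] = r / 2 from [x]. The
   summand 1 keeps [N] positive even when [v] and [w] vanish. *)
pose N := `|v| + `|w| + 1.
have N0 : 0 < N by rewrite ltr_wpDl // addr_ge0.
pose h := r / (N * 2).
have h0 : 0 < h by rewrite divr_gt0 // mulr_gt0.
have Hin s t : 0 <= s <= h -> 0 <= t <= h ->
    [/\ smooth_near f (x + s *: v + t *: w),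
    `|A v w x - A v w (x + s *: v + t *: w)| < e &
    `|A w v x - A w v (x + s *: v + t *: w)| < e].
  move=> /andP[s0 sh] /andP[t0 th]; apply: Hr => /=.
  rewrite -addrA opprD addrA subrr add0r normrN.
  apply: le_lt_trans (ler_normD _ _) _; rewrite !normrZ !ger0_norm //.
  apply: (@le_lt_trans _ _ (h * N)).
    rewrite /N mulrDr mulrDr mulr1; apply: ler_wpDr; first exact: ltW.
    by apply: lerD; exact: ler_wpM2r.
  have -> : h * N = r / 2 by rewrite /h; field; rewrite gt_eqF.
  by rewrite ltr_pdivrMr // ltr_pMr // ltr1n.
have D v' (s t : R) : 0 <= s <= h -> 0 <= t <= h ->
    differentiable f (x + s *: v + t *: w) /\
    differentiable (fun y => 'd f y v' : R^o) (x + s *: v + t *: w).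
  move=> Hs Ht; have [H _ _] := Hin s t Hs Ht.
  split; apply: smooth_near_differentiable => //; exact: smooth_near_diff.
have [s [t [Hs Ht E]]] := second_difference h0 (D v).
have [|t' [s' [Ht' Hs' E']]] := @second_difference f x w v h h0.
  by move=> t' s' Ht' Hs'; rewrite addrAC; exact: D.
have EE : A v w (x + s *: v + t *: w) = A w v (x + s' *: v + t' *: w).
  have hh : h * h != 0 by rewrite mulf_neq0 // gt_eqF.
  apply: (mulIf hh); rewrite 2![_ * (h * h)]mulrA; apply: (etrans (esym E)).
  rewrite [x + s' *: v + _]addrAC; apply: etrans E'.
  by rewrite [x + h *: w + _]addrAC; ring.
have [_ H1 _] := Hin s t Hs Ht; have [_ _ H2] := Hin s' t' Hs' Ht'.
have : `|A v w x - A w v x| < e + e.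
  rewrite -(subrK (A v w (x + s *: v + t *: w)) (A v w x)) -addrA {2}EE.
  apply: le_lt_trans (ler_normD _ _) _; rewrite ltrD // distrC.
  exact: H2.
by rewrite -splitr ltxx.
Unshelve. all: by end_near. Qed.

End Schwarz.

(** * Atlases and covectors *)

Section Dot.
Context {R : realType} {m : nat}.
Implicit Types p u : 'rV[R]_m.

Definition dotr p u : R^o := \sum_j u 0 j * p 0 j.

Lemma dotr_is_linear p : linear (dotr p).
Proof.
move=> a u v; rewrite /dotr scaler_sumr -big_split; apply: eq_bigr => j _ /=.
by rewrite !mxE mulrDl -mulrA.
Qed.

Lemma dotr_delta p j : dotr p (delta_mx 0 j) = p 0 j.
Proof.
rewrite /dotr (bigD1 j) //= mxE !eqxx mul1r big1 ?addr0 // => k kj.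
by rewrite mxE (negbTE kj) andbF mul0r.
Qed.

Lemma dotrC p u : dotr p u = dotr u p.
Proof. by apply: eq_bigr => j _; rewrite mulrC. Qed.

End Dot.

Section SmoothAtlas.
Context (R : realType) (T : Type) (n : nat) (M : atlas R T n).

(* Unlike [is_manifold], this weakening passes to the atlases of the bundles
   without separation or countability arguments. *)
Record smooth_atlas : Prop := {
  sa_cover : forall x, exists i : chart M, dom i x;
  sa_inj : forall (i : chart M) x y,
    dom i x -> dom i y -> coord i x = coord i y -> x = y;
  sa_open : forall i : chart M, open_in M (dom i);
  sa_smooth : forall (i j : chart M) x, dom i x -> dom j x ->
    smooth_near (local_rep i (coord j)) (coord i x) }.

Arguments sa_open : clear implicits.

(** Only the injectivity of one chart enters. The lemma thus applies while an atlas is still being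
    shown to be smooth, and to the charts of the product of a jet bundle with R, for which
    injectivity is what gets proved. *)
Lemma local_rep_inj (W : normedModType R) i (f : T -> W) x :
  (forall y z, dom i y -> dom i z -> coord i y = coord i z -> y = z) ->
  dom i x -> local_rep (i : chart M) f (coord i x) = f x.
Proof.
move=> inj ix; rewrite /local_rep; case: pselect => [e|[]]; last by exists x.
by case: cid => y [iy /= /(inj _ _ iy ix) ->].
Qed.

Hypothesis hM : smooth_atlas.

Lemma local_repE (W : normedModType R) i (f : T -> W) x : dom i x ->
  local_rep (i : chart M) f (coord i x) = f x.
Proof. by apply: local_rep_inj => y z; exact: sa_inj. Qed.

Lemma near_chart (A : set T) (i : chart M) x : open_in M A -> A x -> dom i x ->
  \forall u \near coord i x, exists y, [/\ dom i y, A y & coord i y = u].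
Proof.
move=> oA Ax ix.
have : nbhs (coord i x) (coord i @` (A `&` dom i)).
  by apply: open_nbhs_nbhs; split; [exact: oA|exists x].
by apply: filterS => u [y [Ay iy] <-]; exists y.
Qed.

Lemma near_chart_dom (i : chart M) x : dom i x ->
  \forall u \near coord i x, exists2 y, dom i y & coord i y = u.
Proof.
move=> ix; move: (near_chart (sa_open hM i) ix ix); apply: filterS => u [y [? _ ?]].
by exists y.
Qed.

Lemma near_local_rep_eq (W : normedModType R) (A : set T) (i : chart M) x
    (f g : T -> W) :
  open_in M A -> A x -> dom i x -> (forall y, A y -> dom i y -> f y = g y) ->
  \forall u \near coord i x, local_rep i f u = local_rep i g u.
Proof.
move=> oA Ax ix fg; move: (near_chart oA Ax ix); apply: filterS => _ [y [iy Ay <-]].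
by rewrite !local_repE // fg.
Qed.

Lemma near_local_rep_change (W : normedModType R) (f : T -> W)
    (i j : chart M) x : dom i x -> dom j x ->
  \forall u \near coord j x,
    local_rep i f (local_rep j (coord i) u) = local_rep j f u.
Proof.
move=> ix jx.
move: (near_chart (sa_open hM i) ix jx); apply: filterS => _ [y [jy iy <-]].
by rewrite !local_repE.
Qed.

Lemma smooth_near_change (W : normedModType R) (f : T -> W) (i j : chart M) x :
  dom i x -> dom j x -> smooth_near (local_rep i f) (coord i x) ->
  smooth_near (local_rep j f) (coord j x).
Proof.
move=> ix jx sf; apply: smooth_near_ext (near_local_rep_change f ix jx) _.
by apply: smooth_near_comp; [exact: sa_smooth|rewrite local_repE].
Qed.

Lemma diff_change (W : normedModType R) (f : T -> W) (i j : chart M) x w :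
  dom i x -> dom j x -> smooth_near (local_rep i f) (coord i x) ->
  'd (local_rep j f) (coord j x) w =
  'd (local_rep i f) (coord i x) ('d (local_rep j (coord i)) (coord j x) w).
Proof.
move=> ix jx sf.
have d1 : differentiable (local_rep j (coord i)) (coord j x).
  by apply: smooth_near_differentiable; exact: sa_smooth.
have d2 : differentiable (local_rep i f) (local_rep j (coord i) (coord j x)).
  by rewrite (local_repE _ jx); exact: smooth_near_differentiable.
have [d3 e3] := diff_rV_comp d1 d2.
apply: etrans ((near_eq_is_diff (near_local_rep_change f ix jx) d3).2 w) _.
apply: etrans (e3 w) _.
pose D := 'd (local_rep j (coord i)) (coord j x) w.
exact: (congr1 (fun u => 'd (local_rep i f) u D) (local_repE (coord i) jx)).
Qed.

Lemma diff_gradient m (g : 'rV[R]_m -> R^o) u w :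
  'd g u w = dotr (gradient g u) w.
Proof.
rewrite {1}[w]row_sum_delta linear_sum; apply: eq_bigr => j _.
by rewrite linearZ mxE.
Qed.

Lemma gradient_eq m (g h : 'rV[R]_m -> R^o) u :
  (forall w, 'd g u w = 'd h u w) -> gradient g u = gradient h u.
Proof. by move=> gh; apply: eq_mx => i j; exact: gh. Qed.

Lemma smooth_fun_at_chart (f : T -> R^o) (i : chart M) x : dom i x ->
  smooth_near (local_rep i f) (coord i x) -> smooth_fun_at M f x.
Proof. by move=> ix sf j jx; exact: smooth_near_change sf. Qed.

(** A change of chart acts on differentials by composition with the differential of the transition
    map, so one chart decides for all. *)
Lemma same_differential_chart (f g : T -> R^o) (i : chart M) x : dom i x ->
  smooth_fun_at M f x -> smooth_fun_at M g x ->
  gradient (local_rep i f) (coord i x) = gradient (local_rep i g) (coord i x) ->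
  same_differential M x f g.
Proof.
move=> ix sf sg fg j jx w.
apply: etrans (diff_change _ ix jx (sf _ ix)) _.
apply: etrans _ (esym (diff_change _ ix jx (sg _ ix))).
set D := 'd _ _ w; apply: etrans (diff_gradient _ _ D) _.
by apply: etrans _ (esym (diff_gradient _ _ D)); rewrite fg.
Qed.

Lemma cotangent_ext x (a b : cotangent M x) :
  cotangent_class a = cotangent_class b -> a = b.
Proof.
case: a b => [A HA] [B HB] /= AB; case: _ / AB HB => HB.
by congr Cotangent; exact: Prop_irrelevance.
Qed.

Lemma cotangent_reprP x (a : cotangent M x) :
  smooth_fun_at M (cotangent_repr a) x /\
  cotangent_class a = differential_class M x (cotangent_repr a).
Proof. by rewrite /cotangent_repr; case: cid2. Qed.

Lemma cotangent_repr_smooth x (a : cotangent M x) :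
  smooth_fun_at M (cotangent_repr a) x.
Proof. by have [] := cotangent_reprP a. Qed.

Lemma differential_class_eq x (f g : T -> R^o) :
  same_differential M x f g -> differential_class M x f = differential_class M x g.
Proof.
move=> fg; apply/seteqP; split=> h [sh fh]; (split; first exact: sh); move=> i ix w.
  have e1 := fg i ix w; have e2 := fh i ix w.
  exact (etrans (esym e1) e2).
have e1 := fg i ix w; have e2 := fh i ix w.
exact (etrans e1 e2).
Qed.

Lemma cotangent_eq x (a b : cotangent M x) (i : chart M) : dom i x ->
  gradient (local_rep i (cotangent_repr a)) (coord i x) =
  gradient (local_rep i (cotangent_repr b)) (coord i x) -> a = b.
Proof.
move=> ix ab; apply: cotangent_ext.
have [[sa ->] [sb ->]] := (cotangent_reprP a, cotangent_reprP b).
exact/differential_class_eq/(same_differential_chart ix).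
Qed.

Lemma differential_repr (f : T -> R^o) x (i : chart M) : dom i x ->
  smooth_fun_at M f x ->
  gradient (local_rep i (cotangent_repr (differential M f x))) (coord i x) =
  gradient (local_rep i f) (coord i x).
Proof.
move=> ix sf; rewrite /differential; case: pselect => [h|]; last first.
  by move=> nsf; exact (False_ind _ (nsf sf)).
set a := Cotangent _; have [sa ea] := cotangent_reprP a.
have [_ fa] : cotangent_class a (cotangent_repr a).
  by rewrite ea; split; [exact sa | move=> i' ix' w; reflexivity].
apply: gradient_eq => w; have e := fa i ix w; exact (esym e).
Qed.

Lemma cotangent_differential (f : T -> R^o) x (a : cotangent M x) (i : chart M) :
  dom i x -> smooth_fun_at M f x ->
  gradient (local_rep i (cotangent_repr a)) (coord i x) =
  gradient (local_rep i f) (coord i x) -> a = differential M f x.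
Proof. by move=> ix sf e; apply: (cotangent_eq ix); rewrite differential_repr. Qed.

(** The covector is the differential of the chart followed by the linear form [p]. Hence the induced
    momentum coordinates take all values on each fibre. *)
Lemma cotangent_with_gradient (i : chart M) x (p : 'rV[R]_n) : dom i x ->
  exists a : cotangent M x,
    gradient (local_rep i (cotangent_repr a)) (coord i x) = p.
Proof.
move=> ix; pose L := as_linear (dotr_is_linear p).
exists (differential M (L \o coord i) x).
have E : \forall u \near coord i x, L u = local_rep i (L \o coord i) u.
  by move: (near_chart_dom ix); apply: filterS => _ [y iy <-]; rewrite local_repE.
have Lc := @linear_rV_continuous _ _ _ L.
rewrite differential_repr //.
  apply/rowP => j; rewrite mxE.
  have dL := @linear_differentiable _ _ _ L (coord i x) Lc.
  have e := (near_eq_is_diff E dL).2 (delta_mx 0 j).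
  rewrite [LHS]e.
  by rewrite diff_lin //= dotr_delta.
apply: (smooth_fun_at_chart ix); apply: smooth_near_ext E _.
exact: smooth_near_linear.
Qed.

End SmoothAtlas.

Arguments sa_open {R T n M} _ _.

(** * Line bundles *)

Section Blocks.
Context {R : realType}.
Implicit Types V : normedModType R.

Lemma smooth_near_row_mx V m1 m2 (f : V -> 'rV[R]_m1) (g : V -> 'rV[R]_m2) x :
  smooth_near f x -> smooth_near g x ->
  smooth_near (fun y => row_mx (f y) (g y)) x.
Proof.
move=> sf sg; apply: smooth_near_rV => j.
rewrite -(fintype.splitK j); case: (fintype.split j) => k /=.
  under eq_fun do rewrite row_mxEl; exact: smooth_near_coord.
by under eq_fun do rewrite row_mxEr; exact: smooth_near_coord.
Qed.

Lemma smooth_near_const_mx V (c : V -> R^o) x :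
  smooth_near c x -> smooth_near (fun y => const_mx (c y) : 'rV[R]_1) x.
Proof.
by move=> sc; apply: smooth_near_rV => j; under eq_fun do rewrite mxE.
Qed.

Lemma smooth_near_lsubmx V m1 m2 (f : V -> 'rV[R]_(m1 + m2)) x :
  smooth_near f x -> smooth_near (fun y => lsubmx (f y)) x.
Proof.
move=> sf; apply: smooth_near_rV => j; under eq_fun do rewrite mxE.
exact: smooth_near_coord.
Qed.

Lemma smooth_near_rsubmx V m1 m2 (f : V -> 'rV[R]_(m1 + m2)) x :
  smooth_near f x -> smooth_near (fun y => rsubmx (f y)) x.
Proof.
move=> sf; apply: smooth_near_rV => j; under eq_fun do rewrite mxE.
exact: smooth_near_coord.
Qed.

Lemma smooth_near_id m (x : 'rV[R]_m) : smooth_near id x.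
Proof.
apply: smooth_near_rV => j.
have := @smooth_near_linear R _ _ (coord_linear j) x.
by move=> /(_ (@linear_rV_continuous _ _ _ _)).
Qed.

End Blocks.

Section Constructions.
Context (R : realType) (T : Type) (n : nat).
Implicit Types (N : atlas R T n) (E : line_bundle R T).

Lemma manifold_smooth_atlas N : is_manifold N -> smooth_atlas N.
Proof.
case=> cov inj op sm _ _; split=> // i j x ix jx.
exists (coord i @` (dom i `&` dom j)); split; [|by exists x|exact: sm].
by rewrite setIC; exact: op.
Qed.

(** Charts are injective on their domains, so taking images under a chart commutes with
    intersection. *)
Lemma open_inI N (A B : set T) : smooth_atlas N ->
  open_in N A -> open_in N B -> open_in N (A `&` B).
Proof.
move=> hN oA oB i; rewrite (_ : _ @` _ =
    coord i @` (A `&` dom i) `&` coord i @` (B `&` dom i)).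
  exact: openI.
apply/seteqP; split=> [_ [x [[Ax Bx] ix] <-]|_ [[x [Ax ix] <-] [y [By iy]]]].
  by split; exists x.
by move=> /(sa_inj hN iy ix) yx; exists x => //; split=> //; split=> //; rewrite -yx.
Qed.

(** The analogue for line bundles of [smooth_atlas]: smoothness of the transition functions is
    stated at a point, a form that passes easily to [bar] and [dual]. *)
Record smooth_bundle N E : Prop := {
  sb_cover : forall q, exists a : triv_idx E, triv_dom a q;
  sb_open : forall a : triv_idx E, open_in N (triv_dom a);
  sb_bij : forall (a : triv_idx E) q, triv_dom a q -> bijective (triv a q);
  sb_smooth : forall (a b : triv_idx E) (i : chart N) q,
    triv_dom a q -> triv_dom b q -> dom i q ->
    smooth_near (local_rep i (fun q => triv b q (frame a q))) (coord i q) }.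

Arguments sb_open : clear implicits.

Lemma line_bundle_smooth N E : smooth_atlas N -> is_line_bundle N E ->
  smooth_bundle N E.
Proof.
move=> hN [_ cov op bij sm]; split=> // a b i q aq bq iq.
exists (coord i @` (triv_dom a `&` triv_dom b `&` dom i)); split.
- exact: open_inI.
- by exists q.
- exact: sm.
Qed.

Section Frames.
Context (N : atlas R T n) (E : line_bundle R T).
Hypothesis (hN : smooth_atlas N) (hE : smooth_bundle N E).

Lemma triv_frame (a : triv_idx E) q : triv_dom a q -> triv a q (frame a q) = 1.
Proof.
move=> aq; have [g _ gK] := sb_bij hE aq.
by rewrite /frame limg_lfunVK // -(gK 1) memv_img ?memvf.
Qed.

Lemma frameK (a : triv_idx E) q (v : fib E q) : triv_dom a q ->
  v = triv a q v *: frame a q.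
Proof.
move=> aq; apply: (bij_inj (sb_bij hE aq)).
by rewrite linearZ /= triv_frame // [RHS]mulr1.
Qed.

Lemma triv_change (a b : triv_idx E) q (v : fib E q) : triv_dom a q ->
  triv b q v = triv a q v * triv b q (frame a q).
Proof. by move=> aq; rewrite {1}(frameK v aq) linearZ. Qed.

Lemma triv_neq0 (a : triv_idx E) q (v : fib E q) : triv_dom a q ->
  (triv a q v != 0) = (v != 0).
Proof.
move=> aq; congr (~~ _); apply/eqP/eqP => [|->]; last exact: linear0.
by move=> v0; rewrite (frameK v aq) v0 scale0r.
Qed.

Lemma nonzero_eq (v w : nonzero_vectors E) (a : triv_idx E) :
  triv_dom a (projT1 v) -> projT1 v = projT1 w ->
  triv a (projT1 v) (nonzero_val v) = triv a (projT1 w) (nonzero_val w) -> v = w.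
Proof.
case: v w => [q v] [q' w] /= aq qq'; case: _ / qq' w => w vw.
congr existT; apply: val_inj; exact: (bij_inj (sb_bij hE aq)).
Qed.

Lemma frame_scale_neq0 (a : triv_idx E) q (s : R) : triv_dom a q -> s != 0 ->
  s *: frame a q != 0.
Proof.
by move=> aq s0; rewrite -(triv_neq0 _ aq) linearZ /= triv_frame // [_ *: _]mulr1.
Qed.

Definition frame_vector (a : triv_idx E) q (s : R) (aq : triv_dom a q)
  (s0 : s != 0) : nonzero_vectors E := 
  @existT _ (fun q => {v : fib E q | v != 0}) q
    (exist _ (s *: frame a q) (frame_scale_neq0 aq s0)).

Lemma nonzero_vector_ex (a : triv_idx E) q (s : R) : triv_dom a q -> s != 0 ->
  exists2 v : nonzero_vectors E, projT1 v = q &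
    triv a (projT1 v) (nonzero_val v) = s.
Proof.
move=> aq s0; exists (frame_vector aq s0) => //=.
by rewrite linearZ /= triv_frame // [_ *: _]mulr1.
Qed.

(** In the coordinates (x, s) the preimage of [A] is an open set of base coordinates times the set
    of all s != 0: each such pair is realised by s times the frame. *)
Lemma nonzero_open_in (A : set T) : open_in N A ->
  open_in (nonzero_atlas N E) [set v | A (projT1 v)].
Proof.
move=> oA [i a] /=.
pose B := coord i @` (A `&` triv_dom a `&` dom i).
have oB : open B by apply: open_inI => //; exact: sb_open.
rewrite (_ : _ @` _ = (lsubmx @^-1` B) `&`
    ((fun u : 'rV[R]_(n + 1) => u 0 (rshift n ord0) : R^o) @^-1` [set r : R^o | r != 0])).
  apply: openI; apply: open_comp => //.
  - by move=> u _; exact: continuous_lsubmx.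
  - by move=> u _; exact: coord_continuous.
apply/seteqP; split=> [_ [v [/= Av [iv av]] <-]|u [[q [[Aq aq] iq] qu] /= u0]].
  split=> /=; first by rewrite row_mxKl; exists (projT1 v).
  by rewrite row_mxEr mxE triv_neq0 // (svalP (projT2 v)).
have [v vq vs] := nonzero_vector_ex aq u0.
exists v; first by rewrite /= vq.
rewrite -[u]hsubmxK -qu; apply: (congr2 row_mx); first exact: congr1 vq.
by apply/rowP => j; rewrite !mxE ord1.
Qed.

Lemma nonzero_coord_inj (k : chart (nonzero_atlas N E)) v w :
  dom k v -> dom k w -> coord k v = coord k w -> v = w.
Proof.
case: k => [i a] /= [iv av] [iw aw] /eq_row_mx[vw vw'].
apply: (nonzero_eq av); first exact: sa_inj vw.
by move/rowP/(_ 0) : vw'; rewrite !mxE.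
Qed.

Lemma nonzero_smooth_atlas : smooth_atlas (nonzero_atlas N E).
Proof.
have nonzero_open (k : chart (nonzero_atlas N E)) : open_in N (dom k.1 `&` triv_dom k.2).
  by apply: open_inI => //; [exact: sa_open|exact: sb_open].
split.
- move=> v; have [i iv] := sa_cover hN (projT1 v).
  by have [a av] := sb_cover hE (projT1 v); exists (i, a).
- exact: nonzero_coord_inj.
- by move=> k; exact: nonzero_open_in (nonzero_open k).
move=> [i a] [j b] v /= [iv av] [jv bv].
(* The transition map (x, s) |-> (phi(x), s g(x)), where phi changes the chart of the base and g is
   the transition function of the bundle. *)
pose F (u : 'rV[R]_(n + 1)) := row_mx (local_rep i (coord j) (lsubmx u))
  (const_mx (u 0 (rshift n ord0) *:
     local_rep i (fun q => triv b q (frame a q) : R^o) (lsubmx u))) : 'rV[R]_(n + 1).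
apply: (@smooth_near_ext _ _ _ F).
  have vA : (dom j `&` triv_dom b) (projT1 v) by [].
  have vd : dom ((i, a) : chart (nonzero_atlas N E)) v by [].
  move: (near_chart (nonzero_open_in (nonzero_open (j, b))) vA vd).
  apply: filterS => _ [w [dw Aw <-]].
  rewrite local_rep_inj //; last exact: nonzero_coord_inj.
  have [iw aw] := dw; rewrite /F /= row_mxKl !local_repE // row_mxEr mxE.
  by rewrite (triv_change b (nonzero_val w) aw) [_ *: _]mulrC [X in const_mx X]mulrC.
apply: smooth_near_row_mx; last apply: smooth_near_const_mx.
  apply: smooth_near_comp; first exact/smooth_near_lsubmx/smooth_near_id.
  by rewrite row_mxKl; exact: sa_smooth.
apply: smooth_nearM; first exact/smooth_near_coord/smooth_near_id.
apply: smooth_near_comp; first exact/smooth_near_lsubmx/smooth_near_id.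
by rewrite row_mxKl; exact: sb_smooth.
Qed.

End Frames.

End Constructions.

Arguments sb_open {R T n N E} _ _.

(** * Products with the time line, the bundle bar L, and dual bundles *)

Section TimesR.
Context (R : realType) (T : Type) (n : nat).
Implicit Types (N : atlas R T n) (E : line_bundle R T).

Lemma times_R_open_in N (A : set T) : open_in N A ->
  open_in (times_R N) [set xt | A xt.1].
Proof.
move=> oA i /=; rewrite (_ : _ @` _ =
    (lsubmx : 'rV[R]_(n + 1) -> _) @^-1` (@coord _ _ _ N i @` (A `&` @dom _ _ _ N i))).
  by apply: open_comp => // u _; exact: continuous_lsubmx.
apply/seteqP; split=> [_ [[x t] /= Ax <-]|u [x Ax xu]].
  by rewrite /= row_mxKl; exists x.
exists (x, u 0 (rshift n ord0)) => //=.
rewrite -[RHS]hsubmxK -xu; congr row_mx.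
by apply/rowP => j; rewrite (ord1 j) !mxE.
Qed.

Lemma times_R_coord_inj N (i : chart (times_R N)) x y : smooth_atlas N ->
  dom i x -> dom i y -> coord i x = coord i y -> x = y.
Proof.
move=> hN; case: x y => [x t] [y s] /= ix iy /eq_row_mx[/(sa_inj hN ix iy) <-].
by move/rowP/(_ 0); rewrite !mxE => <-.
Qed.

Lemma near_local_rep_times_R N (W : normedModType R) (f : T -> W)
    (i : chart N) (x : T) (t : R) (u : 'rV[R]_(n + 1)) :
  smooth_atlas N -> dom i x -> u = row_mx (coord i x) (const_mx t) ->
  \forall u' \near u, local_rep i f (lsubmx u') =
    @local_rep R _ _ (times_R N) W i (fun xt => f xt.1) u'.
Proof.
move=> hN ix ->; have oi := times_R_open_in (sa_open hN i).
move: (@near_chart R _ _ (times_R N) _ i (x, t) oi ix ix).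
apply: filterS => _ [[y s] [iy _ <-]].
rewrite [RHS]local_rep_inj //; last by move=> ? ?; exact: times_R_coord_inj.
by rewrite /= row_mxKl local_repE.
Qed.

Lemma times_R_smooth_atlas N : smooth_atlas N -> smooth_atlas (times_R N).
Proof.
move=> hN; split.
- by move=> [x t]; have [i ix] := sa_cover hN x; exists i.
- by move=> i x y; exact: times_R_coord_inj.
- by move=> i; exact: times_R_open_in (sa_open hN i).
move=> i j [x t] /= ix jx.
pose phi := @local_rep _ _ _ N _ i (@coord _ _ _ N j).
apply: (@smooth_near_ext _ _ _ (fun u : 'rV[R]_(n + 1) =>
  row_mx (phi (lsubmx u)) (rsubmx u) : 'rV[R]_(n + 1))).
  have oj := times_R_open_in (sa_open hN j).
  move: (@near_chart R _ _ (times_R N) _ i (x, t) oj jx ix).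
  apply: filterS => _ [[y s] [iy /= jy <-]].
  have inj y' z := @times_R_coord_inj N i y' z hN.
  have e := @local_rep_inj _ _ _ (times_R N) _ i
    (@coord _ _ _ (times_R N) j) (y, s) inj iy.
  by rewrite [RHS]e /= row_mxKl row_mxKr /phi local_repE.
apply: smooth_near_row_mx; last exact/smooth_near_rsubmx/smooth_near_id.
apply: smooth_near_comp; first exact/smooth_near_lsubmx/smooth_near_id.
by rewrite row_mxKl; exact: sa_smooth.
Qed.

(** The transition functions of bar E are those of E, constant in time. *)
Lemma bar_smooth_bundle N E : smooth_atlas N -> smooth_bundle N E ->
  smooth_bundle (times_R N) (bar E).
Proof.
move=> hN hE; split.
- by move=> [q t]; have [a aq] := sb_cover hE q; exists a.
- by move=> a; exact (times_R_open_in (sb_open hE a)).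
- by move=> a [q t] /= aq; exact (sb_bij hE aq).
move=> a b i [q t] /= aq bq iq.
pose g q := @triv _ _ E b q (@frame _ _ E a q) : R^o.
have H := @near_local_rep_times_R N _ g i q t _ hN iq erefl.
refine (smooth_near_ext H _).
apply: smooth_near_comp; first exact/smooth_near_lsubmx/smooth_near_id.
by rewrite row_mxKl; exact: sb_smooth.
Qed.

Section Dual.
Context (N : atlas R T n) (E : line_bundle R T).
Hypothesis (hN : smooth_atlas N) (hE : smooth_bundle N E).

Lemma eval_frame_is_linear (a : triv_idx E) q :
  linear (fun f : 'Hom(fib E q, R^o) => f (frame a q)).
Proof. by move=> c f g; rewrite add_lfunE scale_lfunE. Qed.

Lemma triv_dualE (a : triv_idx E) q (f : 'Hom(fib E q, R^o)) :
  triv (l := dual E) a q f = f (frame a q).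
Proof. exact: (lfunE (as_linear (@eval_frame_is_linear a q)) f). Qed.

Lemma dual_apply (a : triv_idx E) q (f : 'Hom(fib E q, R^o)) (v : fib E q) :
  triv_dom a q -> f v = triv a q v * triv (l := dual E) a q f.
Proof.
by move=> aq; rewrite {1}(frameK hE v aq) linearZ triv_dualE.
Qed.

Lemma triv_dual_inj (a : triv_idx E) q : triv_dom a q ->
  injective (triv (l := dual E) a q).
Proof.
move=> aq f g fg; apply/lfunP => v.
have e1 := dual_apply f v aq; have e2 := dual_apply g v aq.
by rewrite e1 e2 fg.
Qed.

Lemma triv_dual_bij (a : triv_idx E) q : triv_dom a q ->
  bijective (triv (l := dual E) a q).
Proof.
move=> aq; pose g (r : R^o) : 'Hom(fib E q, R^o) := r *: triv a q.
exists g => [f|r]; last first.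
  by rewrite triv_dualE scale_lfunE /= (triv_frame hE aq) [_ *: _]mulr1.
apply: (triv_dual_inj aq); have e := triv_dualE a (g (triv (l := dual E) a q f)).
by rewrite e scale_lfunE /= (triv_frame hE aq) [_ *: _]mulr1.
Qed.

(** The transition function of the dual bundle from [a] to [b] is that of [E] from [b] to [a].
    Smoothness of the dual thus follows by swapping the two trivializations, with no inverse to be
    differentiated. *)
Lemma triv_frame_dual (a b : triv_idx E) q : triv_dom a q -> triv_dom b q ->
  triv (l := dual E) b q (frame (E := dual E) a q) = triv a q (frame b q).
Proof.
move=> aq bq; have e1 := triv_dualE b (frame (E := dual E) a q).
have e2 := dual_apply (frame (E := dual E) a q) (frame b q) aq.
have e : triv (l := dual E) a q (frame (E := dual E) a q) = 1.
  have [g _ gK] := triv_dual_bij aq.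
  by rewrite /frame limg_lfunVK // -(gK 1) memv_img ?memvf.
by rewrite e1 e2 e mulr1.
Qed.

Lemma dual_smooth_bundle : smooth_bundle N (dual E).
Proof.
split; [exact: sb_cover hE|exact: sb_open hE|by move=> a q; exact: triv_dual_bij|].
move=> a b i q /= aq bq iq.
apply: smooth_near_ext (sb_smooth hE bq aq iq).
apply: (@near_local_rep_eq _ _ _ N hN _ (triv_dom a `&` triv_dom b)) => //.
  by apply: open_inI => //; exact (sb_open hE _).
by move=> r [ar br] _; have e := triv_frame_dual ar br; exact (esym e).
Qed.

End Dual.

End TimesR.

(** * 1-jets of sections *)

Section SectionJets.
Context (R : realType) (T : Type) (n : nat) (N : atlas R T n).
Context (E : line_bundle R T).
Hypothesis (hN : smooth_atlas N) (hE : smooth_bundle N E).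
Implicit Types (s r : section E) (i j : chart N) (a b : triv_idx E).

Definition section_coord a s : T -> R^o := fun q => triv a q (s q).

Lemma near_section_change a b i s q : dom i q -> triv_dom a q -> triv_dom b q ->
  \forall u \near coord i q,
    local_rep i (section_coord a s) u *:
      local_rep i (fun q => triv b q (frame a q) : R^o) u =
    local_rep i (section_coord b s) u.
Proof.
move=> iq aq bq.
have oab := open_inI hN (sb_open hE a) (sb_open hE b).
have abq : (triv_dom a `&` triv_dom b) q by [].
move: (near_chart oab abq iq); apply: filterS => _ [y [iy [ay y_] <-]].
rewrite !(local_repE hN _ iy); exact (esym (triv_change hE b (s y) ay)).
Qed.

Lemma smooth_section_at_chart i a s q : dom i q -> triv_dom a q ->
  smooth_near (local_rep i (section_coord a s)) (coord i q) ->
  smooth_section_at N s q.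
Proof.
move=> iq aq sm j b jq bq.
apply: (smooth_near_change hN iq jq).
apply: smooth_near_ext (near_section_change s iq aq bq) _.
exact: smooth_nearM sm (sb_smooth hE aq bq iq).
Qed.

(** Changing the trivialization multiplies the local expression by a smooth function, and the
    differential of the product involves only the value and the differential of the section at [q].
    So one chart and one trivialization decide the 1-jet. *)
Lemma same_jet_chart i a s r q : dom i q -> triv_dom a q ->
  smooth_section_at N s q -> smooth_section_at N r q ->
  section_coord a s q = section_coord a r q ->
  gradient (local_rep i (section_coord a s)) (coord i q) =
  gradient (local_rep i (section_coord a r)) (coord i q) ->
  same_jet N q s r.
Proof.
move=> iq aq ss sr sr0 sr1; split; first exact: bij_inj (sb_bij hE aq) _ _ sr0.
move=> j b jq bq w.
have e1 := diff_change hN w iq jq (ss i b iq bq).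
have e2 := diff_change hN w iq jq (sr i b iq bq).
apply: (etrans e1); apply: etrans (esym e2).
move: ('d _ _ w) => {e1 e2}w'; move: w' => {}w.
have dg := smooth_near_differentiable (sb_smooth hE aq bq iq).
have ds := smooth_near_differentiable (ss i a iq aq).
have dr := smooth_near_differentiable (sr i a iq aq).
have [ds' es'] := diff_scaleM ds dg; have [dr' er'] := diff_scaleM dr dg.
have [_ es] := near_eq_is_diff (near_section_change s iq aq bq) ds'.
have [_ er] := near_eq_is_diff (near_section_change r iq aq bq) dr'.
apply: (etrans (es w)); apply: etrans (esym (er w)).
apply: (etrans (es' w)); apply: etrans (esym (er' w)).
have l0 : local_rep i (section_coord a s) (coord i q) =
          local_rep i (section_coord a r) (coord i q).
  by rewrite !(local_repE hN _ iq).
have l1 : 'd (local_rep i (section_coord a s)) (coord i q) w =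
          'd (local_rep i (section_coord a r)) (coord i q) w.
  have g1 := diff_gradient (local_rep i (section_coord a s)) (coord i q) w.
  have g2 := diff_gradient (local_rep i (section_coord a r)) (coord i q) w.
  exact (etrans g1 (etrans (congr1 (fun p => dotr p w) sr1) (esym g2))).
exact (congr2 (fun (x y : R^o) => x *: _ + y *: _) l0 l1).
Qed.

Lemma jet_ext q (y z : jet N E q) : jet_class y = jet_class z -> y = z.
Proof.
case: y z => [A HA] [B HB] /= AB; case: _ / AB HB => HB.
by congr Jet; exact: Prop_irrelevance.
Qed.

Lemma jet_reprP q (y : jet N E q) :
  smooth_section_at N (jet_repr y) q /\
  jet_class y = jet_set N q (jet_repr y).
Proof. by rewrite /jet_repr; case: cid2. Qed.

Lemma same_jet_set q s r : same_jet N q s r -> jet_set N q s = jet_set N q r.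
Proof.
move=> [sr0 sr]; apply/seteqP; split=> t [st [st0 st1]]; (split; first exact st).
  split; first by rewrite -sr0.
  move=> i a iq aq w; have e1 := sr i a iq aq w; have e2 := st1 i a iq aq w.
  exact (etrans (esym e1) e2).
split; first by rewrite sr0.
move=> i a iq aq w; have e1 := sr i a iq aq w; have e2 := st1 i a iq aq w.
exact (etrans e1 e2).
Qed.

Lemma jet_of_repr s q : smooth_section_at N s q ->
  same_jet N q s (jet_repr (jet_of N s q)).
Proof.
move=> ss; rewrite /jet_of; case: pselect => [h|]; last first.
  by move=> nss; exact (False_ind _ (nss ss)).
set y := Jet _; have [sy ey] := jet_reprP y.
have [_ H] : jet_class y (jet_repr y).
  by rewrite ey; split; [exact sy|split; [reflexivity|move=> *; reflexivity]].
exact H.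
Qed.

Lemma jet_of_eq s r q : smooth_section_at N s q -> smooth_section_at N r q ->
  same_jet N q s r -> jet_of N s q = jet_of N r q.
Proof.
move=> ss sr e; apply: jet_ext; rewrite /jet_of.
case: pselect => [h|]; last by move=> nss; exact (False_ind _ (nss ss)).
case: pselect => [h'|]; last by move=> nss; exact (False_ind _ (nss sr)).
exact: same_jet_set e.
Qed.

Definition jet_coord i a s q : 'rV[R]_(n + 1 + n) :=
  row_mx (row_mx (coord i q) (const_mx (section_coord a s q)))
    (gradient (local_rep i (section_coord a s)) (coord i q)).

Lemma jet_atlas_coord i a (y : jet_bundle N E) :
  @coord _ _ _ (jet_atlas N E) (i, a) y =
  jet_coord i a (jet_repr (projT2 y)) (projT1 y).
Proof. by []. Qed.

Lemma same_jet_coord i a s r q : dom i q -> triv_dom a q ->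
  same_jet N q s r -> jet_coord i a s q = jet_coord i a r q.
Proof.
move=> iq aq [e0 e1]; rewrite /jet_coord.
have -> : section_coord a s q = section_coord a r q.
  by rewrite /section_coord e0.
have e := gradient_eq (e1 i a iq aq).
exact (congr1 (row_mx _) e).
Qed.

Lemma jet_prolongation_coord i a s q : dom i q -> triv_dom a q ->
  smooth_section_at N s q ->
  @coord _ _ _ (jet_atlas N E) (i, a) (jet_prolongation N s q) =
  jet_coord i a s q.
Proof.
move=> iq aq ss; rewrite jet_atlas_coord /=.
have e := same_jet_coord iq aq (jet_of_repr ss); exact (esym e).
Qed.

Lemma jet_coord_inj (k : chart (jet_atlas N E)) y z :
  dom k y -> dom k z -> coord k y = coord k z -> y = z.
Proof.
case: k y z => [i a] [q y] [q' z] [/= iq aq] [/= iq' aq'] /eq_row_mx[/eq_row_mx[e0 e1] e2].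
have qq' := sa_inj hN iq iq' e0.
case: _ / qq' z iq' aq' e1 e2 {e0} => z _ _ e1 e2.
congr existT; apply: jet_ext.
have [[sy ->] [sz ->]] := (jet_reprP y, jet_reprP z).
apply: same_jet_set; apply: (same_jet_chart iq aq sy sz _ e2).
by move/rowP/(_ 0) : e1; rewrite !mxE.
Qed.

(** An affine function of the coordinates with value [z] and slope [p] at [q], times the frame. Away
    from the chart and the trivialization this section takes arbitrary values, which is harmless
    because smoothness is asked at [q] alone. *)
Lemma section_with_jet i a q (z : R) (p : 'rV[R]_n) : dom i q -> triv_dom a q ->
  exists2 s, smooth_section_at N s q &
    jet_coord i a s q = row_mx (row_mx (coord i q) (const_mx z)) p.
Proof.
move=> iq aq; pose L := as_linear (dotr_is_linear p).
pose s : section E := fun q' => (z + L (coord i q' - coord i q)) *: frame a q'.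
have Lc := @linear_rV_continuous _ _ _ L.
pose A u : R^o := z - L (coord i q) + L u.
have E1 q' : triv_dom a q' -> section_coord a s q' = A (coord i q').
  move=> aq'; have LB : L (coord i q' - coord i q) = L (coord i q') - L (coord i q).
    exact: linearB.
  rewrite /section_coord /s LB linearZ; set c := z + _.
  have -> : A (coord i q') = c by rewrite /A /c addrCA addrC.
  by rewrite /= (triv_frame hE aq') [_ *: _]mulr1.
have EA : \forall u \near coord i q, A u = local_rep i (section_coord a s) u.
  move: (near_chart (sb_open hE a) aq iq); apply: filterS => _ [y [iy ay <-]].
  by rewrite (local_repE hN _ iy) E1.
have sA : smooth_near A (coord i q).
  have sL := @smooth_near_linear _ _ _ L (coord i q) Lc.
  exact: (smooth_nearD (smooth_near_cst (z - L (coord i q) : R^o) _) sL).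
exists s; first exact: (smooth_section_at_chart iq aq (smooth_near_ext EA sA)).
rewrite /jet_coord E1 // {1}/A subrK; congr row_mx.
apply/rowP => j; rewrite mxE.
have dL := @linear_differentiable _ _ _ L (coord i q) Lc.
have dc : differentiable (cst (z - L (coord i q) : R^o)) (coord i q).
  exact: differentiable_cst.
have [_ e1] := diff_add dc dL.
have [_ e2] := near_eq_is_diff EA (smooth_near_differentiable sA).
apply: (etrans (e2 _)); apply: (etrans (e1 _)).
by rewrite diff_cst add0r diff_lin //= dotr_delta.
Qed.

End SectionJets.

(** * The projection tau in coordinates *)

Lemma pick_orP (A : Type) (d : A) (P : A -> Prop) :
  (exists x, P x) -> P (pick_or d P).
Proof.
by rewrite /pick_or => ex; case: pselect => [e|//]; exact: projT2 (cid e).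
Qed.

Section TauCoord.
Context (R : realType) (T : Type) (n : nat) (N : atlas R T n).
Context (E : line_bundle R T).
Hypothesis (hN : smooth_atlas N) (hE : smooth_bundle N E).
Implicit Types (s : section (dual E)) (i : chart N) (a : triv_idx E).

Let hD : smooth_bundle N (dual E) := dual_smooth_bundle hN hE.
Let hV : smooth_atlas (nonzero_atlas N E) := nonzero_smooth_atlas hN hE.

Local Notation zsec a s := (@section_coord R T (dual E) a s).
Local Notation vdom i a := (@dom R _ _ (nonzero_atlas N E) (i, a)).
Local Notation vcoord i a := (@coord R _ _ (nonzero_atlas N E) (i, a)).
Local Notation vrep i a := (@local_rep R _ _ (nonzero_atlas N E) _ (i, a)).

(* (x, s, p, z) |-> (x, z, p / s) *)
Definition jet_of_momenta (c : 'rV[R]_((n + 1) + (n + 1))) : 'rV[R]_(n + 1 + n) :=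
  row_mx (row_mx (lsubmx (lsubmx c)) (rsubmx (rsubmx c)))
    ((lsubmx c 0 (rshift n ord0))^-1 *: lsubmx (rsubmx c)).

Lemma iota_apply s a v : triv_dom a (projT1 v) ->
  iota s v = triv a (projT1 v) (nonzero_val v) * zsec a s (projT1 v).
Proof. by move=> av; exact (dual_apply hE (s (projT1 v)) (nonzero_val v) av). Qed.

Lemma near_iota s i a v : vdom i a v ->
  \forall u \near vcoord i a v,
    ((u : 'rV[R]_(n + 1)) 0 (rshift n ord0) : R^o) *:
    local_rep i (zsec a s) (lsubmx (u : 'rV[R]_(n + 1))) = vrep i a (iota s) u.
Proof.
move=> vd; move: (near_chart_dom hV vd); apply: filterS => _ [w [iw aw] <-].
have e := local_repE hV (iota s) (conj iw aw : vdom i a w).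
rewrite [RHS]e row_mxEr mxE row_mxKl (local_repE hN _ iw).
by rewrite (iota_apply s aw).
Qed.

Section AtVector.
Variables (s : section (dual E)) (i : chart N) (a : triv_idx E).
Variable v : nonzero_vectors E.
Hypotheses (vd : vdom i a v) (ss : smooth_section_at N s (projT1 v)).

Let u0 := vcoord i a v.
Let sz : smooth_near (local_rep i (zsec a s)) (lsubmx u0).
Proof. by rewrite /u0 row_mxKl; case: vd => iv av; exact: ss. Qed.

Lemma smooth_near_iota : smooth_near (vrep i a (iota s)) u0.
Proof.
apply: smooth_near_ext (near_iota s vd) _; apply: smooth_nearM.
  exact/smooth_near_coord/smooth_near_id.
by apply: smooth_near_comp sz; exact/smooth_near_lsubmx/smooth_near_id.
Qed.

(** In coordinates iota is s Z(x), whose differential is (s dZ, Z). The momentum conjugate to the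
    fibre coordinate is therefore the value of the section, and the base momenta are its slope
    multiplied by the fibre coordinate: this is where the quotient in [jet_of_momenta] comes
    from. *)
Lemma gradient_iota : gradient (vrep i a (iota s)) u0 =
  row_mx (triv a (projT1 v) (nonzero_val v) *:
            gradient (local_rep i (zsec a s)) (coord i (projT1 v)))
         (const_mx (zsec a s (projT1 v))).
Proof.
have [iv av] := vd.
have dc : differentiable (fun u : 'rV[R]_(n + 1) => u 0 (rshift n ord0) : R^o) u0.
  exact: differentiable_coord.
have dl : differentiable (lsubmx : 'rV[R]_(n + 1) -> 'rV_n) u0.
  exact: differentiable_lsubmx.
have dz := smooth_near_differentiable sz.
have [dzl ezl] := diff_rV_comp dl dz.
have [dm em] := diff_scaleM dc dzl.
have [_ e] := near_eq_is_diff (near_iota s vd) dm.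
have el w : 'd (lsubmx : 'rV[R]_(n + 1) -> 'rV_n) u0 w = lsubmx w.
  by rewrite diff_lin //; exact: continuous_lsubmx.
have ec w : 'd (fun u : 'rV[R]_(n + 1) => u 0 (rshift n ord0) : R^o) u0 w =
    w 0 (rshift n ord0).
  have := @diff_lin _ _ _ (coord_linear (rshift n ord0)) u0.
  by move=> /(_ (@linear_rV_continuous _ _ _ _)) /(congr1 (fun h => h w)).
have u0s : u0 0 (rshift n ord0) = triv a (projT1 v) (nonzero_val v).
  by rewrite /u0 row_mxEr mxE.
have z0 : local_rep i (zsec a s) (lsubmx u0) = zsec a s (projT1 v).
  by rewrite /u0 row_mxKl (local_repE hN _ iv).
have lu0 : lsubmx u0 = coord i (projT1 v) by rewrite /u0 row_mxKl.
have D w : 'd (vrep i a (iota s)) u0 w =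
    triv a (projT1 v) (nonzero_val v) *
      dotr (gradient (local_rep i (zsec a s)) (coord i (projT1 v))) (lsubmx w) +
    w 0 (rshift n ord0) * zsec a s (projT1 v).
  have g := diff_gradient (local_rep i (zsec a s)) (lsubmx u0) (lsubmx w).
  have f1 := ezl w; rewrite el in f1.
  have g' := etrans f1 (etrans g (congr1 (fun u =>
    dotr (gradient (local_rep i (zsec a s)) u) (lsubmx w)) lu0)).
  have H1 := congr2 (fun x y : R^o => x *: y) u0s g'.
  have H2 := congr2 (fun x y : R^o => x *: y) (ec w) z0.
  exact (etrans (e w) (etrans (em w) (congr2 (fun x y : R^o => x + y) H1 H2))).
apply/rowP => j; rewrite mxE; apply: (etrans (D _)).
rewrite -(fintype.splitK j); case: (fintype.split j) => k /=.
  rewrite row_mxEl [RHS]mxE; set g := gradient _ _.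
  have -> : lsubmx (delta_mx 0 (lshift 1 k)) = delta_mx 0 k :> 'rV[R]_n.
    by apply/rowP => l; rewrite !mxE /= (inj_eq (@lshift_inj _ _)).
  by rewrite dotr_delta [X in _ + X * _]mxE /= eq_rlshift mul0r addr0.
rewrite row_mxEr [RHS]mxE (ord1 k).
have -> : lsubmx (delta_mx 0 (rshift n ord0) : 'rV[R]_(n + 1)) = 0.
  by apply/rowP => l; rewrite !mxE /= eq_lrshift.
have -> : dotr (gradient (local_rep i (zsec a s)) (coord i (projT1 v))) 0 = 0.
  by rewrite /dotr big1 // => l _; rewrite mxE mul0r.
by rewrite mulr0 add0r mxE !eqxx mul1r.
Qed.

End AtVector.

Lemma smooth_fun_iota s v : smooth_section_at N s (projT1 v) ->
  smooth_fun_at (nonzero_atlas N E) (iota s) v.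
Proof. by move=> ss [i a] vd; exact: smooth_near_iota. Qed.

(** Shows that the default value in [tau_jet] is never taken. The section is the one whose value is
    the fibre momentum and whose slope is the base momentum divided by the non-zero fibre coordinate
    [t]; by [gradient_iota] its iota has the required differential. *)
Lemma tau_representative (x : cotangent_bundle (nonzero_atlas N E)) :
  exists s, [/\ smooth_section_at N s (projT1 (projT1 x)),
    projT2 x = differential (nonzero_atlas N E) (iota s) (projT1 x) &
    tau_jet x = jet_of N s (projT1 (projT1 x))].
Proof.
refine (@pick_orP _ (jet0 N (dual E) (projT1 (projT1 x)))
  (fun y => exists s : section (dual E),
    [/\ smooth_section_at N s (projT1 (projT1 x)),
        projT2 x = differential (nonzero_atlas N E) (iota s) (projT1 x) &
        y = jet_of N s (projT1 (projT1 x))]) _).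
case: x => v x /=.
have [[i a] vd] := sa_cover hV v; have [iv av] := vd.
set g := gradient (vrep i a (cotangent_repr x)) (vcoord i a v).
pose t := triv a (projT1 v) (nonzero_val v).
have t0 : t != 0 by rewrite (triv_neq0 hE) //; exact: svalP (projT2 v).
have [s ss es] := @section_with_jet _ _ _ N (dual E) hN hD i a (projT1 v)
  (g 0 (rshift n ord0)) (t^-1 *: lsubmx g) iv av.
exists (jet_of N s (projT1 v)), s; split=> //.
apply: (cotangent_differential hV vd (smooth_fun_iota ss)).
have [/eq_row_mx[_ e1] e2] := eq_row_mx es.
have e := gradient_iota vd ss.
apply: etrans (esym e); rewrite e2 scalerA divff // scale1r.
rewrite -/g -[LHS]hsubmxK; congr row_mx.
apply/rowP => j; rewrite (ord1 j) !mxE.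
by move/rowP/(_ 0) : e1; rewrite !mxE => ->.
Qed.

Lemma jet_of_momentaE (x p : 'rV[R]_n) (t z : R) : t != 0 ->
  jet_of_momenta (row_mx (row_mx x (const_mx t))
    (row_mx (t *: p) (const_mx z))) = row_mx (row_mx x (const_mx z)) p.
Proof.
move=> t0; rewrite /jet_of_momenta row_mxKl !row_mxKr !row_mxKl row_mxEr mxE.
by rewrite scalerA mulVf // scale1r.
Qed.

Lemma cotangent_iota_coord i a s (x : cotangent_bundle (nonzero_atlas N E)) :
  vdom i a (projT1 x) -> smooth_section_at N s (projT1 (projT1 x)) ->
  projT2 x = differential (nonzero_atlas N E) (iota s) (projT1 x) ->
  jet_of_momenta (@coord _ _ _ (cotangent_atlas (nonzero_atlas N E)) (i, a) x) =
  @jet_coord R T n N (dual E) i a s (projT1 (projT1 x)).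
Proof.
case: x => v al /= vd ss ea; have [iv av] := vd.
have e := @differential_repr _ _ _ (nonzero_atlas N E) _ _ (i, a) vd
  (smooth_fun_iota ss).
rewrite -ea in e.
have e' := etrans e (gradient_iota vd ss).
have t0 : triv a (projT1 v) (nonzero_val v) != 0.
  have e2 := triv_neq0 hE (nonzero_val v) av.
  by rewrite e2; exact (svalP (projT2 v)).
have H := @jet_of_momentaE (coord i (projT1 v))
  (gradient (local_rep i (zsec a s)) (coord i (projT1 v))) _
  (zsec a s (projT1 v)) t0.
exact (etrans (congr1 (fun g => jet_of_momenta (row_mx _ g)) e') H).
Qed.

(** Whichever section the definition of [tau] selects, the covector fixes its value and slope, so
    the result does not depend on the choice. *)
Lemma tau_coord i a (x : cotangent_bundle (nonzero_atlas N E)) :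
  vdom i a (projT1 x) ->
  @coord _ _ _ (jet_atlas N (dual E)) (i, a) (tau x) =
  jet_of_momenta (@coord _ _ _ (cotangent_atlas (nonzero_atlas N E)) (i, a) x).
Proof.
move=> vd; have [iv av] := vd.
have [s [ss ex et]] := tau_representative x.
have e := @jet_prolongation_coord _ _ _ N (dual E) i a s _ iv av ss.
have e' := cotangent_iota_coord vd ss ex.
have E1 : tau x = jet_prolongation N s (projT1 (projT1 x)) by rewrite /tau et.
exact (etrans (congr1 (@coord _ _ _ (jet_atlas N (dual E)) (i, a)) E1)
  (etrans e (esym e'))).
Qed.

(** The defining property of tau, now for an arbitrary section and not only for the selected one:
    both jets have the same coordinates. *)
Lemma tau_differential s v : smooth_section_at N s (projT1 v) ->
  tau (existT _ v (differential (nonzero_atlas N E) (iota s) v)) =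
  jet_prolongation N s (projT1 v).
Proof.
move=> ss; have [[i a] vd] := sa_cover hV v; have [iv av] := vd.
pose x : cotangent_bundle (nonzero_atlas N E) :=
  existT _ v (differential (nonzero_atlas N E) (iota s) v).
have e := @tau_coord i a x vd.
have e' := @cotangent_iota_coord i a s x vd ss erefl.
have e'' := @jet_prolongation_coord _ _ _ N (dual E) i a s _ iv av ss.
exact (@jet_coord_inj _ _ _ N (dual E) hN hD (i, a) (tau x)
  (jet_prolongation N s (projT1 v)) (conj iv av) (conj iv av)
  (etrans e (etrans e' (esym e'')))).
Qed.

End TauCoord.

(** * Tangent vectors and curves *)

Section Tangent.
Context (R : realType) (T : Type) (n : nat) (M : atlas R T n).

Lemma tangent_ext x (v w : tangent M x) : tangent_class v = tangent_class w -> v = w.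
Proof.
case: v w => [A HA] [B HB] /= AB; case: _ / AB HB => HB.
by congr Tangent; exact: Prop_irrelevance.
Qed.

Lemma tangent_reprP x (v : tangent M x) :
  curve_at M (tangent_repr v) x /\
  tangent_class v = velocity_class M x (tangent_repr v).
Proof. by rewrite /tangent_repr; case: cid2. Qed.

Lemma tangent_class_repr x (v : tangent M x) : tangent_class v (tangent_repr v).
Proof. by have [cv ->] := tangent_reprP v; split. Qed.

Lemma tangent_class_curve x (v : tangent M x) g :
  tangent_class v g -> curve_at M g x.
Proof. by have [_ ->] := tangent_reprP v; case. Qed.

Lemma tangent_class_tcoord x (v : tangent M x) g (i : chart M) :
  tangent_class v g -> dom i x -> tcoord i v = derive1 (coord i \o g) 0.
Proof. by have [_ ->] := tangent_reprP v; move=> [_ sv] ix; exact: sv. Qed.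

Lemma mem_tangent_class x (v : tangent M x) g : curve_at M g x ->
  (forall i : chart M, dom i x -> tcoord i v = derive1 (coord i \o g) 0) ->
  tangent_class v g.
Proof.
move=> cg vg; have [_ ->] := tangent_reprP v.
by split=> // i ix; exact: vg.
Qed.

Lemma tangent_eq_tcoord x (v w : tangent M x) :
  (forall i : chart M, dom i x -> tcoord i v = tcoord i w) -> v = w.
Proof.
move=> vw; apply: tangent_ext; have [[_ ->] [_ ->]] := (tangent_reprP v, tangent_reprP w).
apply/seteqP; split=> g [cg sg]; (split; first exact cg); move=> i ix.
  exact (etrans (esym (vw i ix)) (sg i ix)).
exact (etrans (vw i ix) (sg i ix)).
Qed.

Lemma velocity_tcoord x g (i : chart M) : curve_at M g x -> dom i x ->
  tcoord i (velocity M x g) = derive1 (coord i \o g) 0.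
Proof.
move=> cg ix; apply: tangent_class_tcoord => //.
rewrite /velocity; case: pselect => [h|]; last by move=> nh; case: (nh cg).
by split.
Qed.

Lemma curve_near_open (A : set T) g x : smooth_atlas M -> curve_at M g x ->
  open_in M A -> A x -> \forall r \near (0 : R^o), A (g r).
Proof.
move=> hM [g0 cg] oA Ax; have [i ix] := sa_cover hM x; have [di si] := cg i ix.
have cc := differentiable_continuous (smooth_near_differentiable si).
have nA := near_chart oA Ax ix; rewrite -g0 in nA.
have {}cc := cc _ nA.
apply: filterS2 di cc => r /= ir [y [iy Ay e]].
by rewrite (sa_inj hM ir iy (esym e)).
Qed.

End Tangent.

Section CurveImage.
Context (R : realType) (T T' : Type) (m n : nat).
Context (M : atlas R T m) (N : atlas R T' n).

(** The chart expression [G] is compared with [f] only along the curve [g]. This is all that is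
    needed to differentiate the image curve, and it spares a proof that [f] is smooth as a map of
    manifolds. *)
Definition image_in_charts (f : T -> T') (g : R^o -> T) x (k : chart M)
    (l : chart N) (G : 'rV[R]_m -> 'rV[R]_n) :=
  [/\ dom k x, smooth_near G (coord k x) &
    \forall r \near (0 : R^o), dom l (f (g r)) /\ coord l (f (g r)) = G (coord k (g r))].

Lemma image_derive1 f g x k l G : curve_at M g x -> image_in_charts f g x k l G ->
  smooth_near (coord l \o (f \o g)) (0 : R^o) /\
  derive1 (coord l \o (f \o g)) 0 = 'd G (coord k x) (derive1 (coord k \o g) 0).
Proof.
move=> [g0 cg] [kx sG nG]; have [_ sg] := cg k kx.
have nE : \forall r \near (0 : R^o),
    G (coord k (g r)) = (coord l \o (f \o g)) r.
  by apply: filterS nG => r [_ e]; exact (esym e).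
have sG' : smooth_near G ((coord k \o g) 0) by rewrite /= g0.
have sGg := smooth_near_comp sg sG'.
have sfg := smooth_near_ext nE sGg.
split; first exact: sfg.
have dg := smooth_near_differentiable sg.
have dG := smooth_near_differentiable sG'.
have [dGg eGg] := diff_rV_comp dg dG.
have [_ e] := near_eq_is_diff nE dGg.
have e1 := derive1E' (smooth_near_differentiable sfg).
have e2 := derive1E' dg.
have e3 := congr1 (fun y => 'd G (coord k y) ('d (coord k \o g) 0 1)) g0.
have e4 := congr1 (fun w => 'd G (coord k x) w) (esym e2).
exact (etrans e1 (etrans (e 1) (etrans (eGg 1) (etrans e3 e4)))).
Qed.

Lemma curve_at_image f g x : curve_at M g x ->
  (forall l : chart N, dom l (f x) -> exists k G, image_in_charts f g x k l G) ->
  curve_at N (f \o g) (f x).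
Proof.
move=> cg H; split; first by have [<-] := cg.
move=> l lx; have [k [G im]] := H l lx; split.
  by case: im => _ _; apply: filterS => r [].
by have [] := image_derive1 cg im.
Qed.

End CurveImage.

Section BlockDifferentials.
Context {R : realType}.
Implicit Types V W : normedModType R.

Lemma diff_linear_fun m W (L : 'rV[R]_m -> W) x : linear L ->
  [/\ differentiable L x, smooth_near L x & forall w, 'd L x w = L w].
Proof.
move=> HL; have Lc := @linear_rV_continuous R m W (as_linear HL).
split; first exact: (@linear_differentiable _ _ _ (as_linear HL)).
  exact: (@smooth_near_linear _ _ _ (as_linear HL)).
move=> w; exact (congr1 (fun h => h w) (@diff_lin _ _ _ (as_linear HL) x Lc)).
Qed.

Lemma diff_coord V m (f : V -> 'rV[R]_m) x j : differentiable f x ->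
  differentiable (fun y => f y 0 j : R^o) x /\
  forall w, 'd (fun y => f y 0 j : R^o) x w = 'd f x w 0 j.
Proof.
move=> df; have Lc := @linear_rV_continuous R m _ (coord_linear j).
exact (diff_linear_comp Lc df).
Qed.

Lemma diff_row_mx V m1 m2 (f : V -> 'rV[R]_m1) (g : V -> 'rV[R]_m2) x :
  differentiable f x -> differentiable g x ->
  differentiable (fun y => row_mx (f y) (g y)) x /\
  forall w, 'd (fun y => row_mx (f y) (g y)) x w =
    row_mx ('d f x w) ('d g x w).
Proof.
move=> df dg.
have H j : differentiable (fun y => row_mx (f y) (g y) 0 j : R^o) x /\
    forall w, 'd (fun y => row_mx (f y) (g y) 0 j : R^o) x w =
      row_mx ('d f x w) ('d g x w) 0 j.
  rewrite -(fintype.splitK j); case: (fintype.split j) => k /=.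
    have -> : (fun y => row_mx (f y) (g y) 0 (lshift m2 k) : R^o) =
              (fun y => f y 0 k) by apply: funext => y; rewrite row_mxEl.
    have [d e] := diff_coord k df; split; first exact d.
    move=> w; rewrite row_mxEl; exact (e w).
  have -> : (fun y => row_mx (f y) (g y) 0 (rshift m1 k) : R^o) =
            (fun y => g y 0 k) by apply: funext => y; rewrite row_mxEr.
  have [d e] := diff_coord k dg; split; first exact d.
  move=> w; rewrite row_mxEr; exact (e w).
have [d e] := diff_rV (fun j => (H j).1); split; first exact d.
move=> w; apply: (etrans (e w)); apply/rowP => j; rewrite mxE; exact ((H j).2 w).
Qed.

Lemma diff_const_mx V (f : V -> R^o) x : differentiable f x ->
  differentiable (fun y => const_mx (f y) : 'rV[R]_1) x /\
  forall w, 'd (fun y => const_mx (f y) : 'rV[R]_1) x w = const_mx ('d f x w).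
Proof.
move=> df.
have E : (fun y => const_mx (f y) : 'rV[R]_1) = (fun y => f y *: const_mx 1).
  by apply: funext => y; apply/rowP => j; rewrite !mxE [RHS]mulr1.
have [d e] := diff_scaleM df (differentiable_cst (const_mx 1 : 'rV[R]_1) x).
rewrite E; split; first exact d.
move=> w; apply: (etrans (e w)); rewrite diff_cst scaler0 add0r.
by apply/rowP => j; rewrite !mxE [LHS]mulr1.
Qed.

End BlockDifferentials.

(** * Differentials of tau and of a jet prolongation in coordinates *)

Section JetOfMomenta.
Context {R : realType} {n : nat}.
Implicit Types c w : 'rV[R]_((n + 1) + (n + 1)).

Definition base_part c := lsubmx (lsubmx c) : 'rV[R]_n.
Definition fibre_part c := lsubmx c 0 (rshift n ord0) : R^o.
Definition momentum_part c := lsubmx (rsubmx c) : 'rV[R]_n.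
Definition fibre_momentum_part c := rsubmx (rsubmx c) : 'rV[R]_1.

Lemma base_part_linear : linear base_part.
Proof. by move=> a u v; rewrite /base_part !linearP. Qed.
Lemma fibre_part_linear : linear fibre_part.
Proof. by move=> a u v; rewrite /fibre_part !mxE. Qed.
Lemma momentum_part_linear : linear momentum_part.
Proof. by move=> a u v; rewrite /momentum_part !linearP. Qed.
Lemma fibre_momentum_part_linear : linear fibre_momentum_part.
Proof. by move=> a u v; rewrite /fibre_momentum_part !linearP. Qed.

Lemma smooth_near_jet_of_momenta c : fibre_part c != 0 ->
  smooth_near (@jet_of_momenta R n) c.
Proof.
move=> c0.
have [_ sA _] := diff_linear_fun c base_part_linear.
have [_ sB _] := diff_linear_fun c fibre_part_linear.
have [_ sP _] := diff_linear_fun c momentum_part_linear.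
have [_ sQ _] := diff_linear_fun c fibre_momentum_part_linear.
apply: smooth_near_row_mx; first exact: smooth_near_row_mx sA sQ.
exact: smooth_nearM (smooth_near_inv c0 sB) sP.
Qed.

(** The differential of (x, s, p, z) |-> (x, z, p/s) at a point with s = 1, where the derivative of
    p/s is dp - p ds. *)
Definition diff_momenta (p : 'rV[R]_n) w : 'rV[R]_(n + 1 + n) :=
  row_mx (row_mx (base_part w) (fibre_momentum_part w))
    (momentum_part w - fibre_part w *: p).

Lemma diff_jet_of_momenta c w : fibre_part c = 1 ->
  'd (@jet_of_momenta R n) c w = diff_momenta (momentum_part c) w.
Proof.
move=> c1; have c0 : fibre_part c != 0 by rewrite c1 oner_neq0.
have [dA _ eA] := diff_linear_fun c base_part_linear.
have [dB _ eB] := diff_linear_fun c fibre_part_linear.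
have [dP _ eP] := diff_linear_fun c momentum_part_linear.
have [dQ _ eQ] := diff_linear_fun c fibre_momentum_part_linear.
have [dAQ eAQ] := diff_row_mx dA dQ.
have [dI eI] := diff_inv dB c0.
have [dIP eIP] := diff_scaleM dI dP.
have [_ e] := diff_row_mx dAQ dIP.
apply: (etrans (e w)); apply: (congr2 row_mx).
  exact (etrans (eAQ w) (congr2 (fun x y => row_mx x y) (eA w) (eQ w))).
apply: (etrans (eIP w)).
have h2 := etrans (eI w) (congr1 (fun r : R^o => - (fibre_part c) ^- 2 *: r) (eB w)).
apply: (etrans (congr2 (fun x (y : R^o) => (fibre_part c)^-1 *: x +
  y *: momentum_part c) (eP w) h2)).
by rewrite c1 expr1n !invr1 scale1r scaleN1r scaleNr.
Qed.

End JetOfMomenta.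

Section JetOfFunction.
Context {R : realType} {n : nat}.
Implicit Types (Z : 'rV[R]_n -> R^o) (u w : 'rV[R]_n).

(** The coordinate expression of the prolongation of a section with local expression [Z]. *)
Definition jet_of_function Z u : 'rV[R]_(n + 1 + n) :=
  row_mx (row_mx u (const_mx (Z u))) (gradient Z u).

Lemma smooth_near_gradient Z u : smooth_near Z u -> smooth_near (gradient Z) u.
Proof.
move=> sZ; apply: smooth_near_rV => j.
have -> : (fun y => gradient Z y 0 j : R^o) = (fun y => 'd Z y (delta_mx 0 j)).
  by apply: funext => y; rewrite mxE.
exact: smooth_near_diff.
Qed.

Lemma smooth_near_jet_of_function Z u :
  smooth_near Z u -> smooth_near (jet_of_function Z) u.
Proof.
move=> sZ; apply: smooth_near_row_mx (smooth_near_gradient sZ).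
exact: smooth_near_row_mx (smooth_near_id u) (smooth_near_const_mx sZ).
Qed.

Lemma diff_jet_of_function Z u w : smooth_near Z u ->
  'd (jet_of_function Z) u w =
  row_mx (row_mx w (const_mx (dotr (gradient Z u) w))) ('d (gradient Z) u w).
Proof.
move=> sZ; have dZ := smooth_near_differentiable sZ.
have dG := smooth_near_differentiable (smooth_near_gradient sZ).
have [di _ ei] := diff_linear_fun u (fun a (x y : 'rV[R]_n) => erefl (a *: x + y)).
have [dc ec] := diff_const_mx dZ; have [dic eic] := diff_row_mx di dc.
have [_ e] := diff_row_mx dic dG.
have h := etrans (eic w) (congr2 (fun x y => row_mx x y) (ei w)
  (etrans (ec w) (congr1 (fun r : R => const_mx r) (diff_gradient Z u w)))).
exact (etrans (e w) (congr1 (fun x => row_mx x ('d (gradient Z) u w)) h)).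
Qed.

(** The differential of the gradient is the Hessian, a symmetric form by [diff_diffC]. *)
Lemma diff_gradient_sym Z u w w' : smooth_near Z u ->
  dotr w ('d (gradient Z) u w') = dotr w' ('d (gradient Z) u w).
Proof.
move=> sZ; have dG := smooth_near_differentiable (smooth_near_gradient sZ).
have H v v' : dotr v ('d (gradient Z) u v') = 'd (fun y => 'd Z y v) u v'.
  have dd j : differentiable (fun y => 'd Z y (delta_mx 0 j) : R^o) u.
    exact: smooth_near_differentiable (smooth_near_diff _ sZ).
  have E : (fun y => 'd Z y v) = (fun y => dotr v (gradient Z y)).
    by apply: funext => y; rewrite diff_gradient dotrC.
  have [_ _ el] := diff_linear_fun (gradient Z u) (dotr_is_linear v).
  have [dl _ _] := diff_linear_fun (gradient Z u) (dotr_is_linear v).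
  have [_ e] := diff_rV_comp dG dl.
  rewrite E; exact (esym (etrans (e v') (el _))).
have e1 := H w w'; have e2 := H w' w; have e3 := diff_diffC w w' sZ.
exact (etrans e1 (etrans e3 (esym e2))).
Qed.

End JetOfFunction.

(** * Contact Hamiltonian vector fields *)

Section ContactEquations.
Context {R : realType} {n : nat}.
Variables (X : 'rV[R]_((n + 1) + (n + 1))) (p : 'rV[R]_n).
Variables (D : {linear 'rV[R]_(n + 1 + n) -> R^o}) (b : R).
Hypothesis HX : forall w,
  canonical_form X w = D (diff_momenta p w) + fibre_part w * b.

Local Notation phase x s q z :=
  (row_mx (row_mx x (const_mx s : 'rV[R]_1)) (row_mx q (const_mx z : 'rV[R]_1))).

Let xi := diff_momenta p X.

Lemma row_mx11 (v : 'rV[R]_1) : v = const_mx (v 0 0).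
Proof. by apply/rowP => j; rewrite mxE (ord1 j). Qed.

Lemma canonical_formE (x x' : 'rV[R]_n) (s s' : R) (q q' : 'rV[R]_n) (z z' : R) :
  @canonical_form R (n + 1) (phase x s q z) (phase x' s' q' z') =
  dotr x q' - dotr x' q + (s * z' - s' * z).
Proof.
rewrite /canonical_form big_split_ord /= big_ord1.
rewrite !row_mxKl !row_mxKr; congr (_ + _).
  rewrite (dotrC x) (dotrC x') /dotr -sumrB; apply: eq_bigr => j _.
  by rewrite !row_mxEl.
by rewrite !row_mxEr !mxE.
Qed.

Lemma diff_momentaE (x : 'rV[R]_n) (s : R) (q : 'rV[R]_n) (z : R) :
  diff_momenta p (phase x s q z) =
  row_mx (row_mx x (const_mx z : 'rV[R]_1)) (q - s *: p).
Proof.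
rewrite /diff_momenta /base_part /fibre_part /momentum_part /fibre_momentum_part.
by rewrite !(row_mxKl, row_mxKr) row_mxEr mxE.
Qed.

(** Here [D] stands for the differential of h, [b] for its value, and [HX] is Hamilton's equation
    for H = s h(x, z, p/s) at s = 1. The three conclusions are the components x', z' and P' of the
    projected vector, those in vector spaces being given by their pairing with an arbitrary [v]. *)
Lemma contact_equations :
  [/\ forall v, dotr (lsubmx (lsubmx xi)) v = D (row_mx 0 v),
      rsubmx (lsubmx xi) 0 0 = dotr p (lsubmx (lsubmx xi)) - b &
      forall v, dotr (rsubmx xi) v =
        - D (row_mx (row_mx v (const_mx (dotr p v) : 'rV[R]_1)) 0)].
Proof.
have [x [s [q [z EX]]]] : exists x s q z,
    X = phase x s q z.
  exists (lsubmx (lsubmx X)), (rsubmx (lsubmx X) 0 0),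
    (lsubmx (rsubmx X)), (rsubmx (rsubmx X) 0 0).
  by rewrite -!row_mx11 !hsubmxK.
have H x' s' q' z' : dotr x q' - dotr x' q + (s * z' - s' * z) =
    D (row_mx (row_mx x' (const_mx z' : 'rV[R]_1)) (q' - s' *: p)) + s' * b.
  rewrite -canonical_formE -EX HX diff_momentaE; congr (_ + _ * _).
  by rewrite /fibre_part row_mxKl row_mxEr mxE.
have d0 v : dotr v 0 = 0 :> R by rewrite /dotr big1 // => j _; rewrite mxE mul0r.
have d0' v : dotr 0 v = 0 :> R by rewrite dotrC d0.
have c0 : const_mx 0 = 0 :> 'rV[R]_1 by [].
(* The equation is tested in the four coordinate directions: base momenta ([H1]), fibre coordinate
   ([H2]), fibre momentum ([H3]) and base ([H4]). In [H2] the term p/s contributes the direction -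
   p, which [H1] converts into a pairing with x'. *)
have H1 v : dotr x v = D (row_mx 0 v).
  have := H 0 0 v 0.
  by rewrite d0' subr0 mulr0 !mul0r subr0 addr0 c0 row_mx0 scale0r subr0 addr0.
have H2 : z = dotr p x - b.
  have := H 0 1 0 0.
  rewrite d0 d0' mulr0 !mul1r c0 row_mx0 scale1r !sub0r oppr0 add0r -H1.
  have -> : dotr x (- p) = - dotr p x.
    by rewrite /dotr -sumrN; apply: eq_bigr => j _; rewrite mxE mulNr mulrC.
  by move=> e; rewrite -[z]opprK e opprD opprK.
pose e1 : 'rV[R]_(n + 1 + n) := row_mx (row_mx 0 (const_mx 1 : 'rV[R]_1)) 0.
have H3 : s = D e1.
  have := H 0 0 0 1.
  by rewrite d0 d0' mulr1 !mul0r scale0r !subr0 !addr0 add0r.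
have H4 v : - dotr v q = D (row_mx (row_mx v 0) 0).
  have := H v 0 0 0.
  by rewrite d0 mulr0 !mul0r scale0r !subr0 !addr0 sub0r c0.
rewrite /xi EX diff_momentaE !row_mxKl row_mxKr row_mxKr mxE; split=> // v.
(* The z-component is split off because it produces, through [H3], the term s' p subtracted in the
   derivative of p/s. *)
have -> : row_mx (row_mx v (const_mx (dotr p v) : 'rV[R]_1)) 0 =
    row_mx (row_mx v 0) 0 + (dotr p v : R) *: e1.
  rewrite !scale_row_mx !add_row_mx !scaler0 !addr0 add0r.
  by congr (row_mx (row_mx _ _) _); apply/rowP => j; rewrite !mxE mulr1.
have eD A c : D (A + c *: e1) = D A + c * D e1 by rewrite linearD linearZ.
rewrite eD -H3 -H4.
have -> : dotr (q - s *: p) v = dotr q v - s * dotr p v.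
  rewrite (dotrC _ v) (dotrC q) (dotrC p) /dotr mulr_sumr -sumrB.
  by apply: eq_bigr => j _; rewrite !mxE; ring.
by rewrite (dotrC q); ring.
Qed.

End ContactEquations.

(** As [f] depends on the point only through its coordinates, any preimage that [local_rep] may pick
    gives the same value. *)
Lemma local_rep_coord (R : realType) (T : Type) (n : nat) (M : atlas R T n)
    (W : normedModType R) (i : chart M) (f : T -> W) (F : 'rV[R]_n -> W) u :
  (forall x, dom i x -> f x = F (coord i x)) ->
  (exists2 x, dom i x & coord i x = u) -> local_rep i f u = F u.
Proof.
move=> fF [x ix xu]; rewrite /local_rep; case: pselect => [e|[]]; last by exists x.
by case: cid => y [iy /= <-]; rewrite fF.
Qed.

(** Nearby base coordinates come from points of the chart and every momentum is realised there. A
    formula for a Hamiltonian in coordinates is therefore its representative on a whole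
    neighbourhood, and not merely at points where the extension by 0 is not taken. *)
Lemma near_cotangent_coord (R : realType) (T : Type) (n : nat) (M : atlas R T n)
    (i : chart (cotangent_atlas M)) (x : cotangent_bundle M) :
  smooth_atlas M -> dom i x ->
  \forall c \near coord i x, exists2 y : cotangent_bundle M, dom i y & coord i y = c.
Proof.
move=> hM ix; have nA := @near_chart_dom _ _ _ M hM i (projT1 x) ix.
have lc := @continuous_lsubmx R 1 n n (coord i x).
have nA' : nbhs (lsubmx (coord i x)) [set u | exists2 y, @dom _ _ _ M i y & coord (i : chart M) y = u].
  by rewrite row_mxKl.
have lA : nbhs (coord i x) [set c : 'rV[R]_(n + n) | exists2 y,
    @dom _ _ _ M i y & coord (i : chart M) y = lsubmx c] by exact (lc _ nA').
apply: filterS lA => c [y iy yc].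
have [al al_g] := cotangent_with_gradient hM (rsubmx c) iy.
by exists (existT _ y al) => //=; rewrite al_g yc hsubmxK.
Qed.

Lemma near_eq_derive1 (R : realType) (V : normedModType R) (f g : R^o -> V) t :
  (\forall r \near t, f r = g r) -> derive1 f t = derive1 g t.
Proof.
move=> fg; have e := near_eq_derive (1 : R^o) fg.
exact (etrans (derive1E f t) (etrans e (esym (derive1E g t)))).
Qed.

(** * The three conditions for a section of an arbitrary line bundle *)

Section Autonomous.
Context (R : realType) (T : Type) (n : nat) (N : atlas R T n).
Context (E : line_bundle R T).
Hypothesis (hN : smooth_atlas N) (hE : smooth_bundle N E).
Implicit Types (i : chart N) (a : triv_idx E).

Let hD : smooth_bundle N (dual E) := dual_smooth_bundle hN hE.
Let hV : smooth_atlas (nonzero_atlas N E) := nonzero_smooth_atlas hN hE.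

Local Notation P := (cotangent_bundle (nonzero_atlas N E)).
Local Notation J1 := (jet_bundle N (dual E)).
Local Notation pcoord i a := (@coord _ _ _ (cotangent_atlas (nonzero_atlas N E)) (i, a)).
Local Notation jcoord i a := (@coord _ _ _ (jet_atlas N (dual E)) (i, a)).
Local Notation jdom i a := (@dom _ _ _ (jet_atlas N (dual E)) (i, a)).
Local Notation pdom i a := (@dom _ _ _ (cotangent_atlas (nonzero_atlas N E)) (i, a)).

(** The local function [hb] is left free so that an explicit formula, such as [sigma_bar_rep] below,
    can serve as the representative. *)
Definition differentiable_in_charts (sigma : forall y : J1, fib (dual E) (projT1 y)) :=
  forall i a, exists hb : 'rV[R]_(n + 1 + n) -> R^o, forall y, jdom i a y ->
    differentiable hb (jcoord i a y) /\
    triv (l := dual E) a (projT1 y) (sigma y) = hb (jcoord i a y).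

Variables (sigma : forall y : J1, fib (dual E) (projT1 y)) (H : P -> R^o).
Variables (Xc : vector_field (jet_atlas N (dual E))).
Variable X : vector_field (cotangent_atlas (nonzero_atlas N E)).
Hypothesis (hsigma : differentiable_in_charts sigma).
Hypothesis (hH : forall x, H x = sigma (tau x) (nonzero_val (projT1 x))).
Hypotheses (hX : hamiltonian_field H X) (hXc : related (@tau _ _ _ N E) X Xc).

Lemma fibre_part_coord i a (x : P) : fibre_part (pcoord i a x) =
  triv a (projT1 (projT1 x)) (nonzero_val (projT1 x)).
Proof. by rewrite /fibre_part row_mxKl row_mxEr mxE. Qed.

Lemma fibre_part_neq0 i a (x : P) : pdom i a x -> fibre_part (pcoord i a x) != 0.
Proof.
move=> [_ ax]; rewrite fibre_part_coord.
have e := triv_neq0 hE (nonzero_val (projT1 x)) ax.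
by rewrite e; exact (svalP (projT2 (projT1 x))).
Qed.

Lemma tau_in_charts i a (x : P) g : pdom i a x ->
  curve_at (cotangent_atlas (nonzero_atlas N E)) g x ->
  @image_in_charts _ _ _ _ _ (cotangent_atlas (nonzero_atlas N E))
    (jet_atlas N (dual E)) (@tau _ _ _ N E) g x (i, a) (i, a)
    (@jet_of_momenta R n).
Proof.
move=> xd [_ cg]; have [dg _] := cg (i, a) xd; split; first exact xd.
  exact: smooth_near_jet_of_momenta (fibre_part_neq0 xd).
apply: filterS dg => r dr; split; first exact dr.
exact (tau_coord hN hE dr).
Qed.

Lemma tau_tcoord i a (x : P) : pdom i a x ->
  @tcoord _ _ _ (jet_atlas N (dual E)) (i, a) _ (Xc (tau x)) =
  'd (@jet_of_momenta R n) (pcoord i a x)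
    (@tcoord _ _ _ (cotangent_atlas (nonzero_atlas N E)) (i, a) _ (X x)).
Proof.
move=> xd; have cg := (tangent_reprP (X x)).1.
have ct : curve_at (jet_atlas N (dual E)) (@tau _ _ _ N E \o tangent_repr (X x)) (tau x).
  apply: (curve_at_image cg) => -[i' a'] xd'.
  exists (i', a'), (@jet_of_momenta R n); exact (tau_in_charts xd' cg).
have e := (image_derive1 cg (tau_in_charts xd cg)).2.
have e' := @velocity_tcoord _ _ _ (jet_atlas N (dual E)) (tau x) _ (i, a) ct xd.
rewrite -(hXc x); exact (etrans e' e).
Qed.

(** In coordinates the Hamiltonian is the fibre coordinate times [hb] after tau. The Leibniz rule at
    fibre coordinate 1 gives the hypothesis [HX] of [contact_equations]. *)
Lemma contact_field_coord i a (x : P) hb : pdom i a x ->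
  fibre_part (pcoord i a x) = 1 ->
  (forall y, jdom i a y -> differentiable hb (jcoord i a y) /\
    triv (l := dual E) a (projT1 y) (sigma y) = hb (jcoord i a y)) ->
  forall w, canonical_form
    (@tcoord _ _ _ (cotangent_atlas (nonzero_atlas N E)) (i, a) _ (X x)) w =
  'd hb (jcoord i a (tau x)) (diff_momenta (momentum_part (pcoord i a x)) w) +
    fibre_part w * hb (jcoord i a (tau x)).
Proof.
move=> xd x1 Hhb w.
pose F c : R^o := fibre_part c *: hb (jet_of_momenta c).
have HF y : pdom i a y -> H y = F (pcoord i a y).
  move=> yd; rewrite hH /F -(tau_coord hN hE yd) -(Hhb (tau y) yd).2.
  rewrite fibre_part_coord; exact (dual_apply hE _ _ yd.2).
have nE : \forall c \near pcoord i a x, F c =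
    @local_rep _ _ _ (cotangent_atlas (nonzero_atlas N E)) _ (i, a) H c.
  have nc := @near_cotangent_coord _ _ _ (nonzero_atlas N E) (i, a) x hV xd.
  apply: filterS nc => c ec.
  have e := @local_rep_coord _ _ _ (cotangent_atlas (nonzero_atlas N E)) _ (i, a) H F c HF ec.
  exact (esym e).
have [db _ eb] := diff_linear_fun (pcoord i a x) (@fibre_part_linear R n).
have dG := smooth_near_differentiable
  (smooth_near_jet_of_momenta (fibre_part_neq0 xd)).
have tc := tau_coord hN hE xd.
have dh : differentiable hb (jet_of_momenta (pcoord i a x)).
  rewrite -tc; exact (Hhb (tau x) xd).1.
have [dhG ehG] := diff_rV_comp dG dh.
have [dF eF] := diff_scaleM db dhG.
have [_ e] := near_eq_is_diff nE dF.
have e1 := hX xd w.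
have e2 := etrans e1 (etrans (e w) (eF w)).
have eG := diff_jet_of_momenta w x1.
have e3 := etrans (ehG w) (congr1 ('d hb (jet_of_momenta (pcoord i a x))) eG).
have e4 := congr2 (fun u v : R^o => fibre_part (pcoord i a x) *: u +
  v *: hb (jet_of_momenta (pcoord i a x))) e3 (eb w).
apply: (etrans e2); apply: (etrans e4).
by rewrite x1 scale1r tc.
Qed.

Definition base_of_jet (c : 'rV[R]_(n + 1 + n)) : 'rV[R]_n := lsubmx (lsubmx c).

Lemma base_of_jet_linear : linear base_of_jet.
Proof. by move=> b u v; rewrite /base_of_jet !linearP. Qed.

(** The bundle projection is linear in adapted coordinates, hence equal to its own differential. *)
Lemma projected_curve (y : J1) (v : tangent (jet_atlas N (dual E)) y) g :
  tangent_class v g ->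
  curve_at N (@jet_proj _ _ _ N (dual E) \o g) (projT1 y) /\
  forall i a, jdom i a y ->
    derive1 (coord i \o (@jet_proj _ _ _ N (dual E) \o g)) 0 =
    base_of_jet (@tcoord _ _ _ (jet_atlas N (dual E)) (i, a) _ v).
Proof.
move=> vg; have cg := tangent_class_curve vg.
have im i a : jdom i a y -> @image_in_charts _ _ _ _ _ (jet_atlas N (dual E)) N
    (@jet_proj _ _ _ N (dual E)) g y (i, a) i base_of_jet.
  move=> yd; have [_ sL eL] := diff_linear_fun (jcoord i a y) base_of_jet_linear.
  split; [exact yd|exact sL|]; have [dg _] := cg.2 (i, a) yd.
  apply: filterS dg => r [ir ar]; split; first exact ir.
  by rewrite /base_of_jet /= !row_mxKl.
split.
  apply: (curve_at_image cg) => i iy; have [a ay] := sb_cover hE (projT1 y).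
  by exists (i, a), base_of_jet; exact: im.
move=> i a yd; have [_ _ eL] := diff_linear_fun (jcoord i a y) base_of_jet_linear.
have e := (image_derive1 cg (im i a yd)).2.
have e' := @tangent_class_tcoord _ _ _ (jet_atlas N (dual E)) y v g (i, a) vg yd.
exact (etrans e (etrans (eL _) (congr1 base_of_jet (esym e')))).
Qed.

Variable s : section (dual E).
Hypothesis hs : forall q, smooth_section_at N s q.

Local Notation j1 := (@jet_prolongation R T n N (dual E) s).
Local Notation zrep i a := (local_rep i (@section_coord R T (dual E) a s)).

Lemma jet_prolongation_coordE i a q : jdom i a (j1 q) ->
  jcoord i a (j1 q) = jet_of_function (zrep i a) (coord i q).
Proof.
move=> [iq aq].
have e := @jet_prolongation_coord _ _ _ N (dual E) i a s q iq aq (@hs q).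
have e0 := local_repE hN (@section_coord R T (dual E) a s) (iq : dom i q).
exact (etrans e (congr1 (fun r : R => row_mx (row_mx (coord i q) (const_mx r))
  (gradient (zrep i a) (coord i q))) (esym e0))).
Qed.

Lemma prolonged_curve q h : curve_at N h q ->
  curve_at (jet_atlas N (dual E)) (j1 \o h) (j1 q) /\
  forall i a, jdom i a (j1 q) ->
    derive1 (jcoord i a \o (j1 \o h)) 0 =
    'd (jet_of_function (zrep i a)) (coord i q) (derive1 (coord i \o h) 0).
Proof.
move=> ch.
have im i a : jdom i a (j1 q) -> @image_in_charts _ _ _ _ _ N (jet_atlas N (dual E))
    j1 h q i (i, a) (jet_of_function (zrep i a)).
  move=> [iq aq]; split; first exact iq.
    exact: smooth_near_jet_of_function (hs iq aq).
  have [dh _] := ch.2 i iq; have ah := curve_near_open hN ch (sb_open hE a) aq.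
  apply: filterS2 dh ah => r ir ar; split; first exact (conj ir ar).
  exact (@jet_prolongation_coordE i a (h r) (conj ir ar)).
split; last by move=> i a qd; exact (image_derive1 ch (im i a qd)).2.
apply: (curve_at_image ch) => -[i a] qd.
by exists i, (jet_of_function (zrep i a)); exact: im.
Qed.

(** The contact equations along the prolongation: since [Xc] is tau-related to [X], its value at
    [j1 q] is the image of [X] at any covector over that jet, and a convenient one is chosen. *)
Lemma contact_field_at_jet i a q : jdom i a (j1 q) ->
  let xi := @tcoord _ _ _ (jet_atlas N (dual E)) (i, a) _ (Xc (j1 q)) in
  let p := gradient (zrep i a) (coord i q) in
  exists hb : 'rV[R]_(n + 1 + n) -> R^o,
  [/\ (forall y, jdom i a y -> differentiable hb (jcoord i a y) /\
        triv (l := dual E) a (projT1 y) (sigma y) = hb (jcoord i a y)),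
    forall v, dotr (base_of_jet xi) v = 'd hb (jcoord i a (j1 q)) (row_mx 0 v),
    rsubmx (lsubmx xi) 0 0 = dotr p (base_of_jet xi) - hb (jcoord i a (j1 q)) &
    forall v, dotr (rsubmx xi) v = - 'd hb (jcoord i a (j1 q))
        (row_mx (row_mx v (const_mx (dotr p v) : 'rV[R]_1)) 0)].
Proof.
move=> qd xi p; have iq : dom i q := qd.1; have aq : triv_dom a q := qd.2.
have [hb Hhb] := hsigma i a; exists hb.
(* The field is computed at d(iota s)(v1), where the fibre coordinate is 1. *)
pose v1 := frame_vector hE aq (oner_neq0 R).
pose x : P := existT _ v1 (differential (nonzero_atlas N E) (iota s) v1).
have tx : tau x = j1 q := tau_differential hN hE (@hs (projT1 v1)).
have xd : pdom i a x := conj iq aq.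
have tv : triv a q (nonzero_val v1) = 1.
  by rewrite -[RHS](triv_frame hE aq) /nonzero_val /= scale1r.
have x1 : fibre_part (pcoord i a x) = 1 := etrans (fibre_part_coord i a x) tv.
have xp : momentum_part (pcoord i a x) = p.
  have e := @differential_repr _ _ _ (nonzero_atlas N E) (iota s) v1 (i, a) (conj iq aq)
    (smooth_fun_iota hN hE (@hs (projT1 v1))).
  have e' := etrans e (@gradient_iota _ _ _ N E hN hE s i a v1 (conj iq aq)
    (@hs (projT1 v1))).
  rewrite /momentum_part /= row_mxKr.
  apply: (etrans (congr1 lsubmx e')); rewrite row_mxKl.
  exact (etrans (congr1 (fun r : R => r *: p) tv) (scale1r p)).
have Ham := contact_field_coord xd x1 Hhb.
have [C1 C2 C3] := contact_equations Ham.
have txi := etrans (tau_tcoord xd) (diff_jet_of_momenta _ x1).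
rewrite -txi xp in C1 C2 C3.
by rewrite /xi -tx; split.
Qed.

Lemma sigma_eq0 a y : triv_dom a (projT1 y) ->
  triv (l := dual E) a (projT1 y) (sigma y) = 0 -> sigma y = 0.
Proof.
move=> ay e; apply: (triv_dual_inj hE ay); rewrite e; exact (esym (linear0 _)).
Qed.

(** Tangency forces z' = P.x', and the contact equation says z' = P.x' - h. *)
Lemma vanishing_of_tangent q :
  tangent_to (range j1) (Xc (j1 q)) -> sigma (j1 q) = 0.
Proof.
move=> [g vg ng].
have [ch dh] := projected_curve vg.
set h := _ \o g in ch dh.
have [i iq] := sa_cover hN q; have [a aq] := sb_cover hE q.
have qd : jdom i a (j1 q) by split.
have [hb [Hhb _ C2 _]] := contact_field_at_jet qd.
apply: (@sigma_eq0 a (j1 q) aq); apply: (etrans (Hhb _ qd).2).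
(* A jet in the image of the prolongation is the prolongation at its own base point, so [g] is near
   0 the prolongation of its projection [h]. *)
have nE : \forall r \near (0 : R^o), (jcoord i a \o g) r = (jcoord i a \o (j1 \o h)) r.
  by apply: filterS ng => r [q' _ e]; rewrite /= /h /= -e.
have e1 := @tangent_class_tcoord _ _ _ (jet_atlas N (dual E)) _ _ g (i, a) vg qd.
have e2 : derive1 (jcoord i a \o g) 0 = derive1 (jcoord i a \o (j1 \o h)) 0.
  exact (near_eq_derive1 nE).
have e3 := (prolonged_curve ch).2 i a qd.
have e4 := diff_jet_of_function (derive1 (coord i \o h) 0) (hs iq aq).
have e5 := etrans e1 (etrans e2 (etrans e3 e4)).
have e6 := dh i a qd.
rewrite e6 in e5.
have e7 : rsubmx (lsubmx (@tcoord _ _ _ (jet_atlas N (dual E)) (i, a) _ (Xc (j1 q)))) 0 0 =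
    dotr (gradient (zrep i a) (coord i q))
      (base_of_jet (@tcoord _ _ _ (jet_atlas N (dual E)) (i, a) _ (Xc (j1 q)))).
  apply: (etrans (congr1 (fun c => rsubmx (lsubmx c) 0 0) e5)).
  by rewrite row_mxKl row_mxKr mxE.
have e8 := etrans (esym C2) e7.
by rewrite -[LHS]opprK -[X in - X](addKr (dotr (gradient (zrep i a) (coord i q))
  (base_of_jet (@tcoord _ _ _ (jet_atlas N (dual E)) (i, a) _ (Xc (j1 q)))))) e8
  addNr oppr0.
Qed.

(** A curve representing the contact vector is projected to the base and prolonged again. The new
    curve lies in the image of the section, and it remains to check that its velocity is
    unchanged. *)
Lemma tangent_of_vanishing q : (forall q, sigma (j1 q) = 0) ->
  tangent_to (range j1) (Xc (j1 q)).
Proof.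
move=> s0; pose g := tangent_repr (Xc (j1 q)).
have vg : tangent_class (Xc (j1 q)) g := tangent_class_repr _.
have [ch dh] := projected_curve vg.
set h := _ \o g in ch dh.
exists (j1 \o h); last by near=> r; exists (h r).
apply: (mem_tangent_class (prolonged_curve ch).1) => -[i a] qd.
have iq : dom i q := qd.1; have aq : triv_dom a q := qd.2.
have [hb [Hhb C1 C2 C3]] := contact_field_at_jet qd.
have sz := hs iq aq.
apply: (etrans _ (esym ((prolonged_curve ch).2 i a qd))).
apply: (etrans _ (esym (diff_jet_of_function _ sz))).
have e6 := dh i a qd; rewrite e6 {e6}.
move: C1 C2 C3; set xi := tcoord _ _; set w := base_of_jet xi.
set p := gradient (zrep i a) (coord i q) => C1 C2 C3.
have b0 : hb (jcoord i a (j1 q)) = 0.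
  by rewrite -(Hhb _ qd).2 s0; exact: linear0.
have sJ := smooth_near_jet_of_function sz.
have nE : \forall u \near coord i q, 0 = hb (jet_of_function (zrep i a) u).
  move: (near_chart (sb_open hE a) aq iq); apply: filterS => _ [y [iy ay <-]].
  have yd : jdom i a (j1 y) by split.
  have eJ := jet_prolongation_coordE yd.
  have es := (Hhb _ yd).2; rewrite s0 in es.
  exact (etrans (esym (linear0 _)) (etrans es (congr1 hb eJ))).
have eJ := jet_prolongation_coordE qd.
have dhb : differentiable hb (jet_of_function (zrep i a) (coord i q)).
  by rewrite -eJ; exact (Hhb _ qd).1.
have [dd ed] := diff_rV_comp (smooth_near_differentiable sJ) dhb.
have [_ e0] := near_eq_is_diff nE (differentiable_cst (0 : R^o) (coord i q)).
pose D := 'd hb (jcoord i a (j1 q)).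
pose v0 v : 'rV[R]_(n + 1 + n) := row_mx (row_mx v (const_mx (dotr p v))) 0.
(* The derivative along [v] of the identity h(x, Z(x), dZ(x)) = 0. The first term is - P'.v by [C3];
   the second is x' paired with the Hessian of Z applied to [v], by [C1]. Symmetry of the Hessian
   then moves it onto x'. *)
have V v : D (v0 v) + D (row_mx 0 ('d (gradient (zrep i a)) (coord i q) v)) = 0.
  have h1 := e0 v; have h2 := ed v.
  have h3 : 'd (cst (0 : R^o)) (coord i q) v = 0 by rewrite diff_cst.
  have h4 := congr1 ('d hb (jet_of_function (zrep i a) (coord i q)))
    (diff_jet_of_function v sz).
  have h5 := etrans (esym h4) (etrans (esym h2) (etrans h1 h3)).
  rewrite -eJ in h5.
  rewrite -linearD /v0 add_row_mx addr0 add0r; exact h5.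
rewrite -[LHS]hsubmxK -[lsubmx xi]hsubmxK; congr (row_mx (row_mx _ _) _).
  apply/rowP => j; rewrite (ord1 j) [RHS]mxE; apply: (etrans C2).
  by rewrite b0 subr0.
apply/rowP => k; rewrite -[LHS]dotr_delta.
have h1 := C3 (delta_mx 0 k).
have h2 := V (delta_mx 0 k).
have h3 := C1 ('d (gradient (zrep i a)) (coord i q) (delta_mx 0 k)).
have h4 := diff_gradient_sym w (delta_mx 0 k) sz.
have h5 : dotr (rsubmx xi) (delta_mx 0 k) =
    dotr w ('d (gradient (zrep i a)) (coord i q) (delta_mx 0 k)).
  apply: (etrans h1); apply: (etrans _ (esym h3)).
  by apply/eqP; rewrite eq_sym -addr_eq0 addrC; apply/eqP; exact h2.
apply: (etrans h5); apply: (etrans h4); rewrite dotrC; exact: dotr_delta.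
Unshelve. all: by end_near. Qed.

Definition projection_along : vector_field N :=
  fun q => tangent_map N (@jet_proj _ _ _ N (dual E)) (Xc (j1 q)).

(** The tangent vector is the velocity of a prolonged curve, and this depends on that curve only
    through its velocity in the base. The representative of the projected field has the same base
    velocity, so its prolongation has the same velocity. *)
Lemma related_of_tangent : (forall q, tangent_to (range j1) (Xc (j1 q))) ->
  related j1 projection_along Xc.
Proof.
move=> Ht q; have [g vg ng] := Ht q.
have [ch dh] := projected_curve vg; set h := _ \o g in ch dh.
have vr := tangent_class_repr (Xc (j1 q)).
have [cr dr] := projected_curve vr; set hr := _ \o tangent_repr _ in cr dr.
have vh := tangent_class_repr (projection_along q).
have chq := tangent_class_curve vh.
have [cj dj] := prolonged_curve chq; have [_ djh] := prolonged_curve ch.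
apply: tangent_eq_tcoord => -[i a] qd.
have iq : dom i q := qd.1.
have e1 := @velocity_tcoord _ _ _ (jet_atlas N (dual E)) (j1 q) _ (i, a) cj qd.
have e2 := dj i a qd.
have e3 := @tangent_class_tcoord _ _ _ N q _ _ i vh iq.
have e4 := velocity_tcoord cr iq.
have e5 := dr i a qd.
have e6 := etrans (esym e3) (etrans e4 (etrans e5 (esym (dh i a qd)))).
have e7 := djh i a qd.
have nE : \forall r \near (0 : R^o), (jcoord i a \o g) r = (jcoord i a \o (j1 \o h)) r.
  by apply: filterS ng => r [q' _ e]; rewrite /= /h /= -e.
have e8 : derive1 (jcoord i a \o g) 0 = derive1 (jcoord i a \o (j1 \o h)) 0.
  exact (near_eq_derive1 nE).
have e9 := @tangent_class_tcoord _ _ _ (jet_atlas N (dual E)) _ _ g (i, a) vg qd.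
have e10 := congr1 ('d (jet_of_function (zrep i a)) (coord i q)) e6.
exact (etrans e1 (etrans e2 (etrans e10 (esym (etrans e9 (etrans e8 e7)))))).
Qed.

(** A vector in the image of the tangent map of [j1] is represented by a curve of the form
    [j1 \o c]. *)
Lemma tangent_of_related (Y : vector_field N) : related j1 Y Xc ->
  forall q, tangent_to (range j1) (Xc (j1 q)).
Proof.
move=> HY q; rewrite -(HY q) /tangent_map /velocity.
case: pselect => [cY|_] /=.
  exists (j1 \o tangent_repr (Y q)); first by split.
  by near=> r; exists (tangent_repr (Y q) r).
(* The default branch of [velocity] is the zero vector, represented by a constant curve, which stays
   in the image as well. *)
exists (fun=> j1 q); first by split; first exact: curve_at_cst.
by near=> r; exists q.
Unshelve. all: by end_near. Qed.

End Autonomous.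

(** * The time-dependent case *)

Section RowDelta.
Context {R : realType}.

Lemma row_mx_delta0 m1 m2 (j : 'I_m1) :
  row_mx (delta_mx 0 j) 0 = delta_mx 0 (lshift m2 j) :> 'rV[R]_(m1 + m2).
Proof.
apply/rowP => k; rewrite -(fintype.splitK k); case: (fintype.split k) => l /=.
  by rewrite row_mxEl !mxE (inj_eq (@lshift_inj _ _)).
by rewrite row_mxEr !mxE eq_rlshift.
Qed.

Lemma row_mx0_delta m1 m2 (j : 'I_m2) :
  row_mx 0 (delta_mx 0 j) = delta_mx 0 (rshift m1 j) :> 'rV[R]_(m1 + m2).
Proof.
apply/rowP => k; rewrite -(fintype.splitK k); case: (fintype.split k) => l /=.
  by rewrite row_mxEl !mxE eq_lrshift.
by rewrite row_mxEr !mxE (inj_eq (@rshift_inj _ _)).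
Qed.

Lemma const_mx1_delta : const_mx 1 = delta_mx 0 ord0 :> 'rV[R]_1.
Proof. by apply/rowP => k; rewrite !mxE (ord1 k) !eqxx. Qed.

End RowDelta.

(** * Time slices and time derivatives of sections of bar L *)

Section TimeDependentSections.
Context (R : realType) (T : Type) (n : nat) (Q : atlas R T n).
Context (L : line_bundle R T).
Hypothesis (hQ : smooth_atlas Q) (hL : smooth_bundle Q L).
Implicit Types (i : chart Q) (a : triv_idx L) (q : T) (t : R).

Let hQt : smooth_atlas (times_R Q) := times_R_smooth_atlas hQ.
Let hLb : smooth_bundle (times_R Q) (bar L) := bar_smooth_bundle hQ hL.
Let hD : smooth_bundle Q (dual L) := dual_smooth_bundle hQ hL.

Local Notation rcoord a r := (@section_coord R (T * R) (dual (bar L)) a r).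
Local Notation rrep i a r := (@local_rep R _ _ (times_R Q) _ i (rcoord a r)).
Local Notation scoord a s := (@section_coord R T (dual L) a s).

Lemma time_derivative_is_linear a q (d : R) :
  linear (fun v : fib L q => triv a q v * d : R^o).
Proof. by move=> k u v; rewrite linearP mulrDl -mulrA. Qed.

(** In the trivialization, evaluating [c s] on [v] multiplies its coordinate by the constant
    [triv a q v]. The derivative is thus linear in [v], and [linfun] in [time_derivative] is applied
    to a genuine linear map. *)
Lemma triv_time_derivative a q (c : R -> fib (dual L) q) t : triv_dom a q ->
  differentiable (fun s : R^o => triv (l := dual L) a q (c s) : R^o) t ->
  triv (l := dual L) a q (time_derivative c t) =
  derive1 (fun s : R^o => triv (l := dual L) a q (c s) : R^o) t.
Proof.
move=> aq dc; set d := derive1 _ t.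
rewrite /time_derivative (_ : (fun v => _) = (fun v : fib L q => triv a q v * d : R^o)).
  rewrite triv_dualE.
  apply: (etrans (lfunE (as_linear (@time_derivative_is_linear a q d)) (frame a q))).
  by rewrite /= (triv_frame hL aq) mul1r.
apply: funext => v.
have E : (fun s => c s v) =
    (fun s => triv a q v *: (triv (l := dual L) a q (c s) : R^o)).
  apply: funext => s; exact (dual_apply hL (c s) v aq).
rewrite E.
have [d1 e1] := diff_scaleM (differentiable_cst (triv a q v : R^o) (t : R^o)) dc.
have e2 := derive1E' d1; have e3 := derive1E' dc.
apply: (etrans e2); apply: (etrans (e1 1)); rewrite diff_cst scale0r addr0.
exact (congr1 (fun x : R => triv a q v * x) (esym e3)).
Qed.

Section Slice.
Variables (r : section (dual (bar L))) (q : T) (t : R).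
Hypothesis sr : smooth_section_at (times_R Q) r (q, t).
Variables (i : chart Q) (a : triv_idx L).
Hypotheses (iq : dom i q) (aq : triv_dom a q).

Let S : time_dep_section L := fun q' s => r (q', s).
Let Z := rrep i a r.
Let c0 : 'rV[R]_(n + 1) := row_mx (coord i q) (const_mx t).

Lemma smooth_near_suspension : smooth_near Z c0.
Proof. exact: (sr (iq : @dom _ _ _ (times_R Q) i (q, t)) aq). Qed.

Lemma suspension_rep y s : dom i y ->
  Z (row_mx (coord i y) (const_mx s)) = scoord a (S^~ s) y.
Proof. by move=> iy; exact (@local_repE _ _ _ (times_R Q) hQt _ i (rcoord a r) (y, s) iy). Qed.

Lemma near_slice : \forall u \near coord i q,
  Z (row_mx u (const_mx t)) = local_rep i (scoord a (S^~ t)) u.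
Proof.
move: (near_chart_dom hQ iq); apply: filterS => _ [y iy <-].
by rewrite (local_repE hQ _ iy) suspension_rep.
Qed.

Let B (u : 'rV[R]_n) : 'rV[R]_(n + 1) := row_mx u (const_mx t).

Lemma smooth_near_slice_chart : smooth_near (local_rep i (scoord a (S^~ t))) (coord i q).
Proof.
have sZ : smooth_near Z (B (coord i q)) := smooth_near_suspension.
apply: smooth_near_ext near_slice _; apply: smooth_near_comp sZ.
exact: smooth_near_row_mx (smooth_near_id _) (smooth_near_cst _ _).
Qed.

Lemma smooth_slice : smooth_section_at Q (S^~ t : section (dual L)) q.
Proof. exact: (smooth_section_at_chart hQ hD iq aq smooth_near_slice_chart). Qed.

(** The slice is the local expression restricted to the affine subspace of fixed time, so its
    gradient keeps the space components. *)
Lemma gradient_slice : gradient (local_rep i (scoord a (S^~ t))) (coord i q) =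
  lsubmx (gradient Z c0).
Proof.
have dZ := smooth_near_differentiable smooth_near_suspension.
have [di _ ei] := diff_linear_fun (coord i q) (fun b (x y : 'rV[R]_n) => erefl (b *: x + y)).
have dc := differentiable_cst (const_mx t : 'rV[R]_1) (coord i q).
have [dB eB] := diff_row_mx di dc.
have dZ' : differentiable Z (row_mx (coord i q) (const_mx t)) by exact dZ.
have [dZB eZB] := diff_rV_comp dB dZ'.
have [_ e] := near_eq_is_diff near_slice dZB.
apply/rowP => j; rewrite 3!mxE.
have e1 := etrans (e (delta_mx 0 j)) (eZB (delta_mx 0 j)).
have e2 : 'd (cst (const_mx t : 'rV[R]_1)) (coord i q) (delta_mx 0 j) = 0.
  by rewrite diff_cst.
have e3 := etrans (eB (delta_mx 0 j))
  (congr2 (fun x y => row_mx x y) (ei (delta_mx 0 j)) e2).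
have e4 := @row_mx_delta0 R n 1 j.
exact (etrans e1 (congr1 ('d Z c0) (etrans e3 e4))).
Qed.

Lemma derive_suspension :
  differentiable (fun s : R^o => triv (l := dual L) a q (S q s) : R^o) t /\
  derive1 (fun s : R^o => triv (l := dual L) a q (S q s) : R^o) t =
  gradient Z c0 0 (rshift n ord0).
Proof.
have dZ := smooth_near_differentiable smooth_near_suspension.
have E : (fun s : R^o => triv (l := dual L) a q (S q s) : R^o) =
    (fun s : R^o => Z (row_mx (coord i q) (const_mx s))).
  by apply: funext => s; rewrite suspension_rep.
have did : differentiable (@id R^o) t by exact: ex_diff.
have [dc ec] := diff_const_mx did.
have dx := differentiable_cst (coord i q) (t : R^o).
have [dB eB] := diff_row_mx dx dc.
have dZ' : differentiable Z (row_mx (coord i q) (const_mx t)) by exact dZ.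
have [dZB eZB] := diff_rV_comp dB dZ'.
rewrite E; split; first exact dZB.
apply: (etrans (derive1E' dZB)); rewrite mxE.
have e2 : 'd (cst (coord i q)) (t : R^o) 1 = 0 by rewrite diff_cst.
have e2' : 'd (@id R^o) t 1 = 1 by rewrite diff_val.
have e3 := etrans (eB 1) (congr2 (fun x y => row_mx x y) e2
  (etrans (ec 1) (congr1 (fun r : R => const_mx r) e2'))).
have e4 := etrans (congr1 (row_mx 0) const_mx1_delta) (@row_mx0_delta R n 1 ord0).
exact (etrans (eZB 1) (congr1 ('d Z c0) (etrans e3 e4))).
Qed.

Lemma triv_time_derivative_slice :
  triv (l := dual L) a q (time_derivative (S q) t) = gradient Z c0 0 (rshift n ord0).
Proof.
have [d e] := derive_suspension.
exact (etrans (triv_time_derivative aq d) e).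
Qed.

Lemma slice_jet_coord :
  @coord _ _ _ (jet_atlas Q (dual L)) (i, a) (jet_prolongation Q (S^~ t : section (dual L)) q) =
  row_mx (row_mx (coord i q) (const_mx (rcoord a r (q, t)))) (lsubmx (gradient Z c0)).
Proof.
have e := @jet_prolongation_coord _ _ _ Q (dual L) i a _ q iq aq smooth_slice.
exact (etrans e (congr1 (row_mx _) gradient_slice)).
Qed.

End Slice.

Lemma suspend_smooth (S : time_dep_section L) : smooth_time_dep_section Q S ->
  forall qt, smooth_section_at (times_R Q) (suspend S) qt.
Proof.
move=> hS [q t] i a iq aq.
have [U [oU Uq sub sm]] := hS (q, t) i (i, a) iq (conj iq aq).
have sn : smooth_near (@local_rep _ _ _ (times_R Q) _ i
    (@coord _ _ _ (total_atlas Q (dual L)) (i, a) \o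
      (fun qt => existT (fun q => fib (dual L) q) qt.1 (S qt.1 qt.2))))
    (@coord _ _ _ (times_R Q) i (q, t)).
  by exists U; split.
apply: smooth_near_ext (smooth_near_coord (rshift n ord0) sn).
have H := @near_chart_dom _ _ _ (times_R Q) hQt i (q, t) iq.
apply: filterS H => _ [y iy <-].
have e1 := @local_repE _ _ _ (times_R Q) hQt _ i (rcoord a (suspend S)) y iy.
rewrite [RHS]e1 (@local_repE _ _ _ (times_R Q) hQt) //=.
by rewrite row_mxEr mxE.
Qed.

(** The definition of [sigma_bar0] slices a representative of the jet that may differ from [S]. The
    jet of the slice and the time derivative depend only on the value and the gradient at (q, t),
    hence only on the 1-jet. *)
Lemma sigma_bar0_prolongation (sigma0 : time_dep_morphism Q L)
    (S : time_dep_section L) q t :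
  smooth_section_at (times_R Q) (suspend S) (q, t) ->
  sigma_bar0 sigma0 (j1_tilde Q S (q, t)) =
  sigma0 (jet_prolongation Q (fun q' => S q' t) q) t + time_derivative (S q) t.
Proof.
move=> sS; rewrite /sigma_bar0 /=.
set r := jet_repr _.
have sj : same_jet (times_R Q) (q, t) (suspend S) r := jet_of_repr sS.
have sr : smooth_section_at (times_R Q) r (q, t) := (jet_reprP _).1.
have [i iq] := sa_cover hQ q; have [a aq] := sb_cover hL q.
have eg := gradient_eq (sj.2 i a iq aq).
have e1 : jet_of Q (fun q' => r (q', t) : fib (dual L) q') q =
          jet_of Q (fun q' => S q' t) q.
  have ss := smooth_slice sr iq aq; have ss' := smooth_slice sS iq aq.
  apply: (jet_of_eq ss ss').
  apply: (same_jet_chart hQ hD iq aq ss ss').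
    by rewrite /section_coord -sj.1.
  apply: (etrans (gradient_slice sr iq aq)).
  apply: (etrans _ (esym (gradient_slice sS iq aq))).
  exact (congr1 lsubmx (esym eg)).
have e2 : time_derivative (fun s => r (q, s) : fib (dual L) q) t = time_derivative (S q) t.
  apply: (triv_dual_inj hL aq).
  apply: (etrans (triv_time_derivative_slice sr iq aq)).
  apply: (etrans _ (esym (triv_time_derivative_slice sS iq aq))).
  exact (congr1 (fun g : 'rV[R]_(n + 1) => g 0 (rshift n ord0)) (esym eg)).
by rewrite /jet_prolongation e1 e2.
Qed.

(** * The autonomized section and its Hamiltonian in coordinates *)

Section Morphism.
Variable sigma0 : time_dep_morphism Q L.
Hypothesis hsigma0 : smooth_time_dep_morphism Q sigma0.

Let bundle_map (yt : jet_bundle Q (dual L) * R) : {q : T & fib (dual L) q} :=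
  existT _ (projT1 yt.1) (sigma0 yt.1 yt.2).

Local Notation J1R := (times_R (jet_atlas Q (dual L))).

Definition morphism_rep i a (c : 'rV[R]_(n + 1 + n + 1)) : R^o :=
  @local_rep _ _ _ J1R _ (i, a)
    (@coord _ _ _ (total_atlas Q (dual L)) (i, a) \o bundle_map) c 0 (rshift n ord0).

Lemma differentiable_morphism_rep i a y t :
  @dom _ _ _ (jet_atlas Q (dual L)) (i, a) y ->
  differentiable (morphism_rep i a) (@coord _ _ _ J1R (i, a) (y, t)).
Proof.
move=> yd; have [U [oU Uy sub sm]] := hsigma0 (x := (y, t)) yd yd.
have sn : smooth_near (@local_rep _ _ _ J1R _ (i, a)
    (@coord _ _ _ (total_atlas Q (dual L)) (i, a) \o bundle_map))
    (@coord _ _ _ J1R (i, a) (y, t)) by exists U; split.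
exact: smooth_near_differentiable (smooth_near_coord (rshift n ord0) sn).
Qed.

Lemma morphism_repE i a y t : @dom _ _ _ (jet_atlas Q (dual L)) (i, a) y ->
  triv (l := dual L) a (projT1 y) (sigma0 y t) =
  morphism_rep i a (row_mx (@coord _ _ _ (jet_atlas Q (dual L)) (i, a) y) (const_mx t)).
Proof.
move=> yd.
have inj (x z : jet_bundle Q (dual L) * R) : @dom _ _ _ J1R (i, a) x ->
    @dom _ _ _ J1R (i, a) z -> @coord _ _ _ J1R (i, a) x = @coord _ _ _ J1R (i, a) z -> x = z.
  case: x z => [x t1] [z t2] xd zd /eq_row_mx[e1 e2].
  have -> : x = z := jet_coord_inj hQ hD xd zd e1.
  by move/rowP/(_ 0) : e2; rewrite !mxE /= => ->.
have e := @local_rep_inj _ _ _ J1R _ (i, a)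
  (@coord _ _ _ (total_atlas Q (dual L)) (i, a) \o bundle_map) (y, t) inj yd.
apply: esym; apply: (etrans (congr1 (fun c : 'rV[R]_(n + 1) => c 0 (rshift n ord0)) e)).
by rewrite /= row_mxEr mxE.
Qed.

(* Reorders (q, t, z, p_q, p_t) into (q, z, p_q, t). *)
Definition forget_time_momentum (c : 'rV[R]_(n + 1 + 1 + (n + 1))) :
    'rV[R]_(n + 1 + n + 1) :=
  row_mx (row_mx (row_mx (lsubmx (lsubmx (lsubmx c))) (rsubmx (lsubmx c)))
    (lsubmx (rsubmx c))) (rsubmx (lsubmx (lsubmx c))).

Definition time_momentum (c : 'rV[R]_(n + 1 + 1 + (n + 1))) : R^o :=
  rsubmx c 0 (rshift n ord0).

Lemma forget_time_momentum_linear : linear forget_time_momentum.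
Proof.
move=> k u v; rewrite /forget_time_momentum !linearP.
by rewrite !scale_row_mx !add_row_mx.
Qed.

Lemma time_momentum_linear : linear time_momentum.
Proof. by move=> k u v; rewrite /time_momentum !mxE. Qed.

(** The contact Hamiltonian of Hamilton-Jacobi type h(q, z, p_q, t) + p_t. *)
Definition sigma_bar_rep i a c : R^o :=
  morphism_rep i a (forget_time_momentum c) + time_momentum c.

Lemma sigma_bar0_coord i a (y : jet_bundle (times_R Q) (dual (bar L))) :
  @dom _ _ _ (jet_atlas (times_R Q) (dual (bar L))) (i, a) y ->
  let c := @coord _ _ _ (jet_atlas (times_R Q) (dual (bar L))) (i, a) y in
  differentiable (sigma_bar_rep i a) c /\
  triv (l := dual (bar L)) a (projT1 y) (sigma_bar0 sigma0 y) = sigma_bar_rep i a c.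
Proof.
case: y => [[q t] y] [/= iq aq].
set c := row_mx _ _; set r := jet_repr y in c *.
have sr : smooth_section_at (times_R Q) r (q, t) := (jet_reprP _).1.
pose yq := jet_prolongation Q (fun q' => r (q', t) : fib (dual L) q') q.
have yd : @dom _ _ _ (jet_atlas Q (dual L)) (i, a) yq by split.
have ec : forget_time_momentum c =
    row_mx (@coord _ _ _ (jet_atlas Q (dual L)) (i, a) yq) (const_mx t).
  have e := slice_jet_coord sr iq aq.
  apply: (etrans _ (congr1 (fun x : 'rV[R]_(n + 1 + n) => row_mx x (const_mx t)) (esym e))).
  by rewrite /forget_time_momentum /c !row_mxKl !row_mxKr.
split.
  have [dA _ eA] := diff_linear_fun c forget_time_momentum_linear.
  have [dm _ _] := diff_linear_fun c time_momentum_linear.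
  have dM : differentiable (morphism_rep i a) (forget_time_momentum c).
    by rewrite ec; exact: differentiable_morphism_rep.
  have [dMA _] := diff_rV_comp dA dM.
  exact (diff_add dMA dm).1.
have e1 := @morphism_repE i a yq t yd.
have e2 := triv_time_derivative_slice sr iq aq.
have e3 : triv (l := dual L) a q (sigma0 yq t +
     time_derivative (fun s => r (q, s) : fib (dual L) q) t) =
   triv (l := dual L) a q (sigma0 yq t) +
   triv (l := dual L) a q (time_derivative (fun s => r (q, s) : fib (dual L) q) t).
  exact: linearD.
apply: (etrans e3); rewrite /sigma_bar_rep ec.
apply: (congr2 (fun x y : R => x + y) e1).
apply: (etrans e2); rewrite /time_momentum /c row_mxKr //.
Qed.

(** * Space and time components of a covector on the non-zero vectors of bar L *)

Section Covector.
Variables (q : T) (t : R) (v : {v : fib L q | v != 0}).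
Let w : nonzero_vectors (bar L) :=
  @existT _ (fun qt => {v : fib (bar L) qt | v != 0}) (q, t) v.
Let v' : nonzero_vectors L := @existT _ (fun q => {v : fib L q | v != 0}) q v.
Variable f : nonzero_vectors (bar L) -> R^o.
Hypothesis sf : smooth_fun_at (nonzero_atlas (times_R Q) (bar L)) f w.
Variables (i : chart Q) (a : triv_idx L).
Hypotheses (iq : dom i q) (aq : triv_dom a q).

Let hV : smooth_atlas (nonzero_atlas Q L) := nonzero_smooth_atlas hQ hL.
Let hVb : smooth_atlas (nonzero_atlas (times_R Q) (bar L)) :=
  nonzero_smooth_atlas hQt hLb.
Let F := @local_rep _ _ _ (nonzero_atlas (times_R Q) (bar L)) _ (i, a) f.
Let s : R := triv a q (sval v).
Let c0 : 'rV[R]_(n + 1 + 1) := row_mx (row_mx (coord i q) (const_mx t)) (const_mx s).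

Lemma smooth_near_covector_rep : smooth_near F c0.
Proof.
exact: (sf (i := (i, a)) (conj iq aq : @dom _ _ _ (nonzero_atlas (times_R Q) (bar L)) (i, a) w)).
Qed.

Lemma covector_repE t' (z : nonzero_vectors L) :
  @dom _ _ _ (nonzero_atlas Q L) (i, a) z ->
  F (row_mx (row_mx (coord i (projT1 z)) (const_mx t'))
    (const_mx (triv a (projT1 z) (nonzero_val z)))) = f (at_time t' z).
Proof.
move=> zd.
exact (@local_repE _ _ _ (nonzero_atlas (times_R Q) (bar L)) hVb _ (i, a) f (at_time t' z) zd).
Qed.

Let B (u : 'rV[R]_(n + 1)) : 'rV[R]_(n + 1 + 1) :=
  row_mx (row_mx (lsubmx u) (const_mx t)) (rsubmx u).
Let u0 : 'rV[R]_(n + 1) := row_mx (coord i q) (const_mx s).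

Lemma near_space_part : \forall u \near u0, F (B u) =
  @local_rep _ _ _ (nonzero_atlas Q L) _ (i, a) (f \o at_time t) u.
Proof.
have vd : @dom _ _ _ (nonzero_atlas Q L) (i, a) v' by split.
have H := @near_chart_dom _ _ _ (nonzero_atlas Q L) hV (i, a) v' vd.
apply: filterS H => _ [z zd <-].
have e := @local_repE _ _ _ (nonzero_atlas Q L) hV _ (i, a) (f \o at_time t) z zd.
rewrite [RHS]e -[RHS](covector_repE t zd) /B.
by rewrite /= row_mxKl row_mxKr.
Qed.

Let BE : B u0 = c0. Proof. by rewrite /B /u0 row_mxKl row_mxKr. Qed.

Lemma space_part_smooth :
  smooth_fun_at (nonzero_atlas Q L) (f \o at_time t) v'.
Proof.
have vd : @dom _ _ _ (nonzero_atlas Q L) (i, a) v' by split.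
apply: (smooth_fun_at_chart hV vd).
apply: smooth_near_ext near_space_part _.
have sF : smooth_near F (B u0) by rewrite BE; exact: smooth_near_covector_rep.
apply: smooth_near_comp sF; apply: smooth_near_row_mx.
  apply: smooth_near_row_mx (smooth_near_cst _ _).
  exact/smooth_near_lsubmx/smooth_near_id.
exact/smooth_near_rsubmx/smooth_near_id.
Qed.

(** With coordinates (x, t, s), freezing the time drops the t-entry of the gradient and keeps those
    of x and s. *)
Lemma gradient_space_part :
  gradient (@local_rep _ _ _ (nonzero_atlas Q L) _ (i, a) (f \o at_time t)) u0 =
  row_mx (lsubmx (lsubmx (gradient F c0))) (rsubmx (gradient F c0)).
Proof.
have dF := smooth_near_differentiable smooth_near_covector_rep; rewrite -BE in dF.
have [dl _ el] := diff_linear_fun u0 (fun k x y => linearP (lsubmx : 'rV[R]_(n + 1) -> 'rV_n) k x y).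
have [dr _ er] := diff_linear_fun u0 (fun k x y => linearP (rsubmx : 'rV[R]_(n + 1) -> 'rV_1) k x y).
have dc := differentiable_cst (const_mx t : 'rV[R]_1) u0.
have [dlc elc] := diff_row_mx dl dc.
have [dB eB] := diff_row_mx dlc dr.
have [dFB eFB] := diff_rV_comp dB dF.
have [_ e] := near_eq_is_diff near_space_part dFB.
have D d : 'd (@local_rep _ _ _ (nonzero_atlas Q L) _ (i, a) (f \o at_time t)) u0 d =
    'd F c0 (row_mx (row_mx (lsubmx d) 0) (rsubmx d)).
  have e1 := etrans (e d) (eFB d).
  have e2 : 'd (cst (const_mx t : 'rV[R]_1)) u0 d = 0 by rewrite diff_cst.
  have e3 := etrans (elc d) (congr2 (fun x y => row_mx x y) (el d) e2).
  have e4 := etrans (eB d) (congr2 (fun x y => row_mx x y) e3 (er d)).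
  rewrite -BE; exact (etrans e1 (congr1 ('d F (B u0)) e4)).
apply/rowP => k; rewrite [LHS]mxE; apply: (etrans (D _)).
rewrite -(fintype.splitK k); case: (fintype.split k) => l /=.
  rewrite row_mxEl 3![RHS]mxE; apply: congr1.
  by rewrite -row_mx_delta0 row_mxKl row_mxKr !row_mx_delta0.
rewrite row_mxEr 2![RHS]mxE; apply: congr1.
by rewrite -row_mx0_delta row_mxKl row_mxKr row_mx0 row_mx0_delta.
Qed.

Lemma derive_time_part : derive1 (fun t' : R => f (at_time t' v')) t =
  lsubmx (gradient F c0) 0 (rshift n ord0).
Proof.
have dF := smooth_near_differentiable smooth_near_covector_rep.
have vd : @dom _ _ _ (nonzero_atlas Q L) (i, a) v' by split.
have E : (fun t' : R^o => f (at_time t' v')) =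
    (fun t' => F (row_mx (row_mx (coord i q) (const_mx t')) (const_mx s))).
  by apply: funext => t'; exact (esym (covector_repE t' vd)).
have did : differentiable (@id R^o) t by exact: ex_diff.
have [dc ec] := diff_const_mx did.
have dx := differentiable_cst (coord i q) (t : R^o).
have ds := differentiable_cst (const_mx s : 'rV[R]_1) (t : R^o).
have [dxc exc] := diff_row_mx dx dc.
have [dB eB] := diff_row_mx dxc ds.
have [dFB eFB] := diff_rV_comp dB dF.
rewrite (_ : (fun t' => _) = (fun t' : R^o => f (at_time t' v'))) // E.
apply: (etrans (derive1E' dFB)); rewrite [RHS]mxE [RHS]mxE.
have e1 : 'd (cst (coord i q)) (t : R^o) 1 = 0 by rewrite diff_cst.
have e2 : 'd (cst (const_mx s : 'rV[R]_1)) (t : R^o) 1 = 0 by rewrite diff_cst.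
have e3 : 'd (@id R^o) t 1 = 1 by rewrite diff_val.
have e4 := etrans (exc 1) (congr2 (fun x y => row_mx x y) e1
  (etrans (ec 1) (congr1 (fun r : R => const_mx r) e3))).
have e5 := etrans (eB 1) (congr2 (fun x y => row_mx x y) e4 e2).
have e6 : row_mx (row_mx 0 (const_mx 1)) 0 =
    delta_mx 0 (lshift 1 (rshift n ord0)) :> 'rV[R]_(n + 1 + 1).
  by rewrite const_mx1_delta row_mx0_delta row_mx_delta0.
exact (etrans (eFB 1) (congr1 ('d F c0) (etrans e5 e6))).
Qed.

End Covector.

(** Let the covector have momenta (G_x, G_t, G_s). Its image under tau has slope (G_x/s, G_t/s) and
    value G_s, so pairing [sigma_bar0] with the vector gives s (h(x, G_s, G_x/s, t) + G_t/s) = s h +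
    G_t. The factor s cancels exactly on the time momentum, leaving the summand p of the
    autonomization. *)
Lemma H_barE (x : cotangent_bundle (nonzero_atlas (times_R Q) (bar L))) :
  H_bar sigma0 x = sigma_bar0 sigma0 (tau x) (nonzero_val (projT1 x)).
Proof.
case: x => -[[q t] v] al; set x : cotangent_bundle _ := existT _ _ al.
have [i iq] := sa_cover hQ q; have [a aq] := sb_cover hL q.
have sf := cotangent_repr_smooth al.
pose F := @local_rep _ _ _ (nonzero_atlas (times_R Q) (bar L)) _ (i, a) (cotangent_repr al).
pose s : R := triv a q (sval v).
pose c0 : 'rV[R]_(n + 1 + 1) :=
  row_mx (row_mx (coord i q) (const_mx t)) (const_mx s).
pose G := gradient F c0.
have s0 : s != 0.
  have e := triv_neq0 hL (sval v) aq; rewrite /s e; exact (svalP v).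
pose v' : nonzero_vectors L := @existT _ (fun q => {v : fib L q | v != 0}) q v.
have vd : @dom _ _ _ (nonzero_atlas Q L) (i, a) v' by split.
have eb := @differential_repr _ _ _ (nonzero_atlas Q L) _ v' (i, a) vd
  (space_part_smooth sf iq aq).
have eg := etrans eb (gradient_space_part sf iq aq).
pose b := cotangent_space_part x.
have bd : @dom _ _ _ (cotangent_atlas (nonzero_atlas Q L)) (i, a) b by split.
have xd : @dom _ _ _ (cotangent_atlas (nonzero_atlas (times_R Q) (bar L))) (i, a) x by split.
have cb : @coord _ _ _ (jet_atlas Q (dual L)) (i, a) (tau b) =
    row_mx (row_mx (coord i q) (rsubmx G)) (s^-1 *: lsubmx (lsubmx G)).
  apply: (etrans (tau_coord hQ hL bd)).
  apply: (etrans (congr1 (fun g => jet_of_momenta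
    (row_mx (row_mx (coord i q) (const_mx s)) g)) eg)).
  by rewrite /jet_of_momenta row_mxKl !row_mxKr !row_mxKl row_mxEr mxE.
have cx : @coord _ _ _ (jet_atlas (times_R Q) (dual (bar L))) (i, a) (tau x) =
    row_mx (row_mx (row_mx (coord i q) (const_mx t)) (rsubmx G)) (s^-1 *: lsubmx G).
  apply: (etrans (tau_coord hQt hLb xd)).
  rewrite -[LHS]/(jet_of_momenta (row_mx c0 G)).
  by rewrite /jet_of_momenta row_mxKl !row_mxKr !row_mxKl row_mxEr mxE.
have h1 := dual_apply hL (sigma0 (tau b) t) (sval v) aq.
have h2 := @morphism_repE i a (tau b) t bd; rewrite cb in h2.
have h3 := derive_time_part sf iq aq.
have h4 := dual_apply hLb (sigma_bar0 sigma0 (tau x)) (sval v) (aq : triv_dom (l := bar L) a (q, t)).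
have h5 := (@sigma_bar0_coord i a (tau x) xd).2; rewrite cx in h5.
have l1 := etrans h1 (congr1 (fun r : R => s * r) h2).
have l2 := etrans h4 (congr1 (fun r : R => s * r) h5).
apply: (etrans (congr2 (fun x y : R => x + y) l1 h3)); apply: (etrans _ (esym l2)).
rewrite /sigma_bar_rep /forget_time_momentum /time_momentum.
rewrite !(row_mxKl, row_mxKr).
rewrite mulrDr; congr (s * morphism_rep i a _ + _).
  by rewrite !linearZ.
by move: (lsubmx G) => g; rewrite [X in s * X]mxE mulrA divff // mul1r.
Qed.

End Morphism.

End TimeDependentSections.

Theorem theorem6p7 (R : realType) (T : Type) (n : nat) (Q : atlas R T n)
  (L : line_bundle R T) (hQ : is_manifold Q) (hL : is_line_bundle Q L)
  (sigma0 : time_dep_morphism Q L) (hsigma0 : smooth_time_dep_morphism Q sigma0)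
  (S : time_dep_section L) (hS : smooth_time_dep_section Q S)
  (Xc : vector_field (jet_atlas (times_R Q) (dual (bar L))))
  (hXc : contact_hamiltonian_field (H_bar sigma0) Xc) :
  [/\ (* the two forms of (1) *)
      (forall y, legendre Q S y -> sigma_bar0 sigma0 y = 0) <->
      (forall (q : T) (t : R),
         sigma0 (jet_prolongation Q (fun q' => S q' t) q) t
         + time_derivative (S q) t = 0),
      (* (1) <-> (2) *)
      (forall y, legendre Q S y -> sigma_bar0 sigma0 y = 0) <->
      (forall y, legendre Q S y -> tangent_to (legendre Q S) (Xc y)) &
      (* (2) <-> (3) *)
      (forall y, legendre Q S y -> tangent_to (legendre Q S) (Xc y)) <->
      related (j1_tilde Q S) (projected_field S Xc) Xc ].
Proof.
have aQ := manifold_smooth_atlas hQ.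
have bL := line_bundle_smooth aQ hL.
have aQt := times_R_smooth_atlas aQ.
have bLb := bar_smooth_bundle aQ bL.
have sS := suspend_smooth aQ hS.
have [X hX hXX] := hXc.
have hsigma : differentiable_in_charts (sigma_bar0 sigma0).
  move=> i a; exists (sigma_bar_rep sigma0 i a) => y yd.
  exact (sigma_bar0_coord aQ bL hsigma0 yd).
have hH := H_barE aQ bL hsigma0.
(* The Legendre submanifold is the range of the prolongation, so conditions on it become conditions
   indexed by the points of Q x R, as in the results for an arbitrary line bundle. *)
have on_graph (P : jet_bundle (times_R Q) (dual (bar L)) -> Prop) :
    (forall y, legendre Q S y -> P y) <-> (forall qt, P (j1_tilde Q S qt)).
  by split=> [HP qt|HP _ [qt _ <-]]; [apply: HP; exists qt|exact: HP].
have vanishing_tangent := vanishing_of_tangent aQt bLb hsigma hH hX hXX sS.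
have tangent_vanishing := tangent_of_vanishing aQt bLb hsigma hH hX hXX sS.
split.
- apply: iff_trans (on_graph _) _; split=> [H q t|H [q t]].
    by rewrite -(sigma_bar0_prolongation aQ bL _ (@sS (q, t))) H.
  by rewrite (sigma_bar0_prolongation aQ bL _ (@sS (q, t))) H.
- apply: iff_trans (on_graph _) _; apply: iff_trans _ (iff_sym (on_graph _)).
  split=> H qt; first exact: tangent_vanishing.
  exact: vanishing_tangent (H qt).
(* For the bundle bar L, [projected_field] unfolds to [projection_along]. *)
apply: iff_trans (on_graph _) _; split=> H.
  exact: (related_of_tangent aQt bLb sS H).
exact: (tangent_of_related H).
Qed.
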